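(* Let $\{\rho_\theta\mid\theta\in\Theta\subset\mathbb{R}^d\}$, $\Theta$ open, be a quantum statistical model on a finite dimensional Hilbert space $\mathcal{H}$, and suppose that, for some $\theta_0\in\Theta$, a version $R_h$ of the square-root likelihood ratio $\mathcal{R}(\rho_{\theta_0+h}\mid\rho_{\theta_0})$ is differentiable at $h=0$, and the absolutely continuous part of $\rho_{\theta_0+h}$ with respect to $\rho_{\theta_0}$ satisfies $$\mathrm{Tr}\,\rho_{\theta_0}R_h^2=1-o(\|h\|^2).$$ Then $\{\rho_\theta^{\otimes n}\mid\theta\in\Theta\subset\mathbb{R}^d\}$ is locally asymptotically normal at $\theta_0$, in that $$\Delta_i^{(n)}:=\frac1{\sqrt n}\sum_{k=1}^nI^{\otimes(k-1)}\otimes L_i\otimes I^{\otimes(n-k)}$$ satisfies conditions (i) and (ii) below, where $L_i$ is (a version of) the $i$th symmetric logarithmic derivative at $\theta_0$ and $J=(J_{ij})$ is given by $J_{ij}:=\mathrm{Tr}\,\rho_{\theta_0}L_jL_i$: (i) $\Delta^{(n)}=(\Delta_1^{(n)},\dots,\Delta_d^{(n)})$ satisfies $\Delta^{(n)}\overset{\rho_{\theta_0}^{\otimes n}}{\rightsquigarrow}N(0,J)$, where $J$ is a $d\times d$ Hermitian positive semidefinite matrix with $\mathrm{Re}\,J>0$, and (ii) the square-root likelihood ratio $R_h^{(n)}=\mathcal{R}(\rho_{\theta_0+h/\sqrt n}^{\otimes n}\mid\rho_{\theta_0}^{\otimes n})$ is expanded in $h\in\mathbb{R}^d$ as $$R_h^{(n)}=\exp\Big\{\tfrac12\Big(h^i\Delta_i^{(n)}-\tfrac12(J_{ij}h^ih^j)I^{(n)}+o_D\big(h^i\Delta_i^{(n)},\rho_{\theta_0}^{\otimes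 n}\big)\Big)\Big\}-o_{L^2}\big(\rho_{\theta_0}^{\otimes n}\big),$$ with $I^{(n)}$ the identity on $\mathcal{H}^{\otimes n}$. Further, given observables $\{B_i\}_{1\le i\le d'}$ on $\mathcal{H}$ satisfying $\mathrm{Tr}\,\rho_{\theta_0}B_i=0$ for $i=1,\dots,d'$, let $X^{(n)}=\{X_i^{(n)}\}_{1\le i\le d'}$ be the observables on $\mathcal{H}^{\otimes n}$ defined by $$X_i^{(n)}:=\frac1{\sqrt n}\sum_{k=1}^nI^{\otimes(k-1)}\otimes B_i\otimes I^{\otimes(n-k)}.$$ Then $$\rho_{\theta_0+h/\sqrt n}^{\otimes n}\vartriangleleft\rho_{\theta_0}^{\otimes n}\qquad\text{and}\qquad X^{(n)}\ \overset{\rho_{\theta_0+h/\sqrt n}^{\otimes n}}{\rightsquigarrow}\ N((\mathrm{Re}\,\tau)h,\Sigma)$$ for $h\in\mathbb{R}^d$, where $\Sigma$ is the $d'\times d'$ positive semidefinite matrix defined by $\Sigma_{ij}=\mathrm{Tr}\,\rho_{\theta_0}B_jB_i$ and $\tau$ is the $d'\times d$ matrix defined by $\tau_{ij}=\mathrm{Tr}\,\rho_{\theta_0}L_jB_i$.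
   Context: Summation over repeated indices is understood; $\prod_{t=1}^rA_t=A_1A_2\cdots A_r$. Quantum states are density operators, and a quantum statistical model is a parametric family of density operators; observables on finite dimensional spaces are Hermitian operators; ''positive'' means positive semidefinite. For fixed $h$, $\theta_0+h/\sqrt n\in\Theta$ for all sufficiently large $n$, and only such $n$ are considered. A version of the $i$th symmetric logarithmic derivative (SLD) at $\theta_0$ is a Hermitian operator $L_i$ with $\partial_i\rho_\theta|_{\theta=\theta_0}=\frac12(L_i\rho_{\theta_0}+\rho_{\theta_0}L_i)$. Square-root likelihood ratio: for positive operators on a finite dimensional Hilbert space $\mathcal{H}$, $\mathrm{supp}\,\rho:=(\ker\rho)^\perp$; $\sigma\!\downharpoonleft_{\mathrm{supp}\,\rho}:=\iota_\rho^*\sigma\iota_\rho$ with $\iota_\rho:\mathrm{supp}\,\rho\hookrightarrow\mathcal{H}$ the inclusion; $\rho\perp\sigma$ means $\sigma\!\downharpoonleft_{\mathrm{supp}\,\rho}=0$ (a symmetric relation). A version of $\mathcal{R}(\sigma\mid\rho)$ is any positive operator $R$ such that $\sigma=R\rho R+\tau'$ with $\tau'\ge0$, $\tau'\perp\rho$ (such $R$ exists); $R\rho R$ is the absolutely continuous part of $\sigma$ with respect to $\rho$, so that $\mathrm{Tr}\,\rho_{\theta_0}R_h^2$ is the trace of the absolutely continuous part of $\rho_{\theta_0+h}$. Infinitesimals: a sequence of observables $O^{(n)}=o_{L^2}(\rho^{(n)})$ if $\lim_n\mathrm{Tr}\,\rho^{(n)}O^{(n)2}=0$; $O^{(n)}=o_D(Z^{(n)},\rho^{(n)})$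 if $\lim_n\mathrm{Tr}\,\rho^{(n)}\prod_{t=1}^re^{\sqrt{-1}(\xi_tZ^{(n)}+\eta_tO^{(n)})}=\lim_n\mathrm{Tr}\,\rho^{(n)}\prod_{t=1}^re^{\sqrt{-1}\xi_tZ^{(n)}}$ for all $r\in\mathbb{N}$ and $\{\xi_t\}_{t=1}^r,\{\eta_t\}_{t=1}^r\subset\mathbb{R}$. Contiguity: let $\mathbf{1}_M(x)=1$ if $|x|\le M$ and $0$ otherwise. For positive operators $A^{(n)}$, $A^{(n)2}$ is uniformly integrable under $\rho^{(n)}$ if for every $\varepsilon>0$ there is $M>0$ with $\sup_n\mathrm{Tr}\,\rho^{(n)}A^{(n)2}(I-\mathbf{1}_M(A^{(n)}))<\varepsilon$. $\sigma^{(n)}\vartriangleleft\rho^{(n)}$ means: with $R^{(n)}$ a version of $\mathcal{R}(\sigma^{(n)}\mid\rho^{(n)})$, (a) $\lim_n\mathrm{Tr}\,\rho^{(n)}R^{(n)2}=1$, and (b) there is $O^{(n)}=o_{L^2}(\rho^{(n)})$ such that $R^{(n)}+O^{(n)}$ is positive and $(R^{(n)}+O^{(n)})^2$ is uniformly integrable under $\rho^{(n)}$ (independent of the version). Convergence to a quantum Gaussian state: for $h\in\mathbb{R}^m$ and a Hermitian positive semidefinite $m\times m$ matrix $J=V+\sqrt{-1}S$ ($V$ real symmetric, $S$ real skew-symmetric), $N(h,J)$ is the state $\phi$ on the algebra generated by canonical observables $Y_1,\dots,Y_m$ with $\frac{\sqrt{-1}}{2}[Y_i,Y_j]=S_{ij}$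 having characteristic function $\phi(e^{\sqrt{-1}\xi^iY_i})=e^{\sqrt{-1}\xi^ih_i-\frac12\xi^i\xi^jV_{ij}}$; its quasi-characteristic function is $$\phi\Big(\prod_{t=1}^re^{\sqrt{-1}\xi_t^iY_i}\Big)=\exp\Big(\sum_{t=1}^r\big(\sqrt{-1}\xi_t^ih_i-\tfrac12\xi_t^i\xi_t^jJ_{ji}\big)-\sum_{t=1}^r\sum_{u=t+1}^r\xi_t^i\xi_u^jJ_{ji}\Big).$$ $Y^{(n)}\overset{\rho^{(n)}}{\rightsquigarrow}N(h,J)$ means that $\lim_n\mathrm{Tr}\,\rho^{(n)}\prod_{t=1}^re^{\sqrt{-1}\xi_t^iY_i^{(n)}}$ equals this right-hand side for all $r\in\mathbb{N}$ and $\{\xi_t\}_{t=1}^r\subset\mathbb{R}^m$.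
   Formalization: The claim Re J > 0 in (i) is made only when the partial derivatives of ρ_θ at θ_0 are linearly independent over the reals; without this it fails (a constant model has J = 0). All other conclusions are stated without this condition. *)

(* Defs.v *)
From HB Require Import structures.
From mathcomp Require Import all_boot all_order all_algebra.
From mathcomp Require Import all_classical all_reals all_analysis.
From mathcomp Require Import complex mxtens spectral sesquilinear.

Set Implicit Arguments.
Unset Strict Implicit.
Unset Printing Implicit Defensive.

Import Order.TTheory GRing.Theory Num.Theory.
Import numFieldNormedType.Exports.

Local Open Scope classical_set_scope.
Local Open Scope ring_scope.
Local Open Scope complex_scope.
Local Open Scope sesquilinear_scope.

(* A finite dimensional Hilbert space is taken to be C^D with its standard
   inner product, where C = R[i] for a real number structure R. *)

Section Operators.
Variables (R : realType) (D : nat).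
Implicit Types A rho sigma tau : 'M[R[i]]_D.

Definition psd A : Prop :=
  A \is hermsymmx /\ forall v : 'cV[R[i]]_D, 0 <= (v^t* *m A *m v) 0 0.

Definition density A : Prop := psd A /\ \tr A = 1.

(* supp rho is the orthogonal complement of ker rho. *)
Definition in_supp rho (v : 'cV[R[i]]_D) : Prop :=
  forall u : 'cV[R[i]]_D, rho *m u = 0 -> u^t* *m v = 0.

(* The compression of sigma to supp rho vanishes, tested on matrix elements. *)
Definition singular_to rho sigma : Prop :=
  forall u v : 'cV[R[i]]_D,
    in_supp rho u -> in_supp rho v -> u^t* *m sigma *m v = 0.

(* A is a version of the square-root likelihood ratio R(sigma | rho). *)
Definition sqrt_lr sigma rho A : Prop :=
  psd A /\
  exists tau, [/\ psd tau, singular_to tau rho & sigma = A *m rho *m A + tau].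

(* Functional calculus f(A) of a Hermitian matrix A: spectral_diag A lists the
   eigenvalues of A, and A = P^-1 diag(spectral_diag A) P with P unitary. *)
Definition hfun (f : R -> R[i]) A : 'M[R[i]]_D :=
  invmx (spectralmx A)
  *m diag_mx (map_mx (fun z => f (complex.Re z)) (spectral_diag A))
  *m spectralmx A.

Definition expH A : 'M[R[i]]_D := hfun (fun x => (expR x)%:C) A.

(* exp(sqrt(-1) A) *)
Definition expiH A : 'M[R[i]]_D := hfun (fun x => cos x +i* sin x) A.

(* 1_M(A), with 1_M(x) = 1 if |x| <= M and 0 otherwise *)
Definition truncH (M : R) A : 'M[R[i]]_D :=
  hfun (fun x => if `|x| <= M then 1 else 0) A.

Definition half_anticomm A rho : 'M[R[i]]_D :=
  2%:R^-1 *: (A *m rho + rho *m A).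

End Operators.

Section TensorPower.
Variables (R : realType) (D : nat).

(* dim (H^{(x) n}) = D ^ n *)
Fixpoint tdim (n : nat) : nat :=
  if n is n'.+1 then (D * tdim n')%N else 1%N.

(* tprod n A = A_0 (x) A_1 (x) ... (x) A_(n-1) *)
Fixpoint tprod (n : nat) : ('I_n -> 'M[R[i]]_D) -> 'M[R[i]]_(tdim n) :=
  match n with
  | 0%N => fun _ => 1%:M
  | n'.+1 => fun A => A ord0 *t tprod (fun k => A (lift ord0 k))
  end.

Definition tpow (n : nat) (A : 'M[R[i]]_D) : 'M[R[i]]_(tdim n) :=
  tprod (fun _ : 'I_n => A).

(* I (x) ... (x) I (x) A (x) I (x) ... (x) I with A at position k *)
Definition tsite (n : nat) (k : 'I_n) (A : 'M[R[i]]_D) : 'M[R[i]]_(tdim n) :=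
  tprod (fun l : 'I_n => if l == k then A else 1%:M).

Definition normalized_sum (A : 'M[R[i]]_D) (n : nat) : 'M[R[i]]_(tdim n) :=
  ((Num.sqrt n%:R)^-1)%:C *: \sum_(k < n) tsite k A.

End TensorPower.

Section Derivatives.
Variables (R : realType) (d D : nat).
Implicit Types (F : 'rV[R]_d -> 'M[R[i]]_D) (x v : 'rV[R]_d).

(* Real differentiability of a complex matrix valued map, read on the real and
   imaginary parts of the entries. *)
Definition mx_differentiable F x : Prop :=
  forall a b, differentiable (fun y => complex.Re (F y a b)) x /\
              differentiable (fun y => complex.Im (F y a b)) x.

Definition mx_is_derive F x v (dF : 'M[R[i]]_D) : Prop :=
  forall a b,
    is_derive x v (fun y => complex.Re (F y a b)) (complex.Re (dF a b)) /\
    is_derive x v (fun y => complex.Im (F y a b)) (complex.Im (dF a b)).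

(* L is a version of the i-th symmetric logarithmic derivative of rho at x. *)
Definition is_sld (rho : 'rV[R]_d -> 'M[R[i]]_D) x (i : 'I_d)
    (L : 'M[R[i]]_D) : Prop :=
  L \is hermsymmx /\
  mx_is_derive rho x (delta_mx 0 i) (half_anticomm L (rho x)).

End Derivatives.

Section Asymptotics.
Variable R : realType.

Definition ccvg (u : nat -> R[i]) (l : R[i]) : Prop :=
  (complex.Re (u n) @[n --> \oo] --> complex.Re l) /\
  (complex.Im (u n) @[n --> \oo] --> complex.Im l).

Definition cexp (z : R[i]) : R[i] :=
  (expR (complex.Re z))%:C * (cos (complex.Im z) +i* sin (complex.Im z)).

(* Sequences of matrices of varying size: the n-th one acts on C^(dim n). *)
Variable dim : nat -> nat.
Implicit Types rho sigma A O Z : forall n, 'M[R[i]]_(dim n).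

Definition oL2 rho O : Prop :=
  (forall n, O n \is hermsymmx) /\
  ccvg (fun n => \tr (rho n *m (O n *m O n))) 0.

Definition oD Z rho O : Prop :=
  (forall n, O n \is hermsymmx) /\
  forall (r : nat) (xi eta : 'I_r -> R), exists l : R[i],
    ccvg (fun n => \tr (rho n *m \big[mulmx/1%:M]_(t < r)
                    expiH ((xi t)%:C *: Z n + (eta t)%:C *: O n))) l /\
    ccvg (fun n => \tr (rho n *m \big[mulmx/1%:M]_(t < r)
                    expiH ((xi t)%:C *: Z n))) l.

(* In the next two definitions E is the set of the indices n under
   consideration. *)
Definition sq_unif_integrable (E : set nat) rho A : Prop :=
  forall eps : R, 0 < eps -> exists2 M : R, 0 < M &
    (ereal_sup [set (complex.Re (\tr (rho n *m (A n *m A n)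
                       *m (1%:M - truncH M (A n)))))%:E | n in E]
     < eps%:E)%E.

Definition contiguous (E : set nat) sigma rho : Prop :=
  exists A : forall n, 'M[R[i]]_(dim n),
    [/\ forall n, E n -> sqrt_lr (sigma n) (rho n) (A n),
        ccvg (fun n => \tr (rho n *m (A n *m A n))) 1 &
        exists O : forall n, 'M[R[i]]_(dim n),
          [/\ oL2 rho O, forall n, E n -> psd (A n + O n) &
              sq_unif_integrable E rho (fun n => A n + O n)]].

(* Quasi-characteristic function of N(h, J) at xi_0, ..., xi_(r-1). *)
Definition gauss_qchar (m : nat) (h : 'rV[R]_m) (J : 'M[R[i]]_m)
    (r : nat) (xi : 'I_r -> 'rV[R]_m) : R[i] :=
  cexp (\sum_(t < r)
          ((0 +i* \sum_i xi t 0 i * h 0 i)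
           - 2%:R^-1 * \sum_i \sum_j (xi t 0 i)%:C * (xi t 0 j)%:C * J j i)
        - \sum_(t < r) \sum_(u < r | (t < u)%N) \sum_i \sum_j
            (xi t 0 i)%:C * (xi u 0 j)%:C * J j i).

(* Y^(n) ~~> N(h, J) under rho^(n) *)
Definition cvg_gauss (m : nat) (Y : forall n, 'I_m -> 'M[R[i]]_(dim n)) rho
    (h : 'rV[R]_m) (J : 'M[R[i]]_m) : Prop :=
  forall (r : nat) (xi : 'I_r -> 'rV[R]_m),
    ccvg (fun n => \tr (rho n *m \big[mulmx/1%:M]_(t < r)
                    expiH (\sum_i (xi t 0 i)%:C *: Y n i)))
         (gauss_qchar h J xi).

End Asymptotics.

Definition local_param (R : realType) (d : nat) (theta0 h : 'rV[R]_d)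
    (n : nat) : 'rV[R]_d :=
  theta0 + (Num.sqrt n%:R)^-1 *: h.

Definition admissible (R : realType) (d : nat) (Theta : set 'rV[R]_d)
    (theta0 h : 'rV[R]_d) : set nat :=
  [set n | (0 < n)%N /\ Theta (local_param theta0 h n)].

(* Main.v *)
Require Import Defs.
From HB Require Import structures.
From mathcomp Require Import all_boot all_order all_algebra.
From mathcomp Require Import all_classical all_reals all_analysis.
From mathcomp Require Import complex mxtens spectral sesquilinear.
From mathcomp Require Import ring lra.

Set Implicit Arguments.
Unset Strict Implicit.
Unset Printing Implicit Defensive.

Import Order.TTheory GRing.Theory Num.Theory.
Import numFieldNormedType.Exports.

Import ComplexField.Normc.

Local Open Scope classical_set_scope.
Local Open Scope ring_scope.
Local Open Scope complex_scope.
Local Open Scope sesquilinear_scope.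

(** Every limit is read off a second-order expansion on a single system. A
    multiplicative function of a normalized sum is a tensor power
    ([hfun_normalized_sum]), the trace of a tensor power is a power, and
    [u n ^+ n] tends to [cexp z] as soon as [n (u n - 1)] tends to [z]
    ([cto_expn]). It remains to expand traces of matrices of fixed size in
    powers of [1 / sqrt n].

    Let [A] be the derivative of [Rh] at [0] in the direction [h]. Two versions
    of the square-root likelihood ratio agree after multiplication by [rho]
    ([sqrt_lr_uniq]); comparing [Rh 0] with the identity gives
    [Rh 0 rho0 = rho0]. The singular part of [rho (theta0 + h)] is positive with
    trace [o(|h|^2)], so [rho] has the derivative [A rho0 + rho0 A]: hence [2 A]
    is a symmetric logarithmic derivative, and any other version [L] satisfies
    [L rho0 = 2 A rho0] ([sld_rho0]). Expanding [rho (theta0 + h / sqrt n)] to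
    first order and a product of exponentials to second order gives the limiting
    quasi-characteristic function ([cvg_gauss_normalized_sum]); the mean comes
    from pairing [A rho0 + rho0 A] with the first-order term of the product.
    The central limit theorem for the score is the case [h = 0].

    The likelihood ratio of the tensor powers is compared with the amplitude
    [exp ((h Delta - J / 2) / 2)]. The mean squared difference expands into three
    limits [1 - 2 + 1] ([amplitude_approx]). The middle one needs
    [\tr (rho0 Rh)] up to second order although [Rh] is only differentiable once;
    the missing term is supplied by the condition on [\tr (rho0 Rh^2)]
    ([tr_Rt_second]). The likelihood ratio is therefore exactly an exponential
    minus an [L^2]-infinitesimal, with zero as the infinitesimal inside the
    exponent. Adding the same [L^2]-infinitesimal to the likelihood ratio gives
    the amplitude, whose square is uniformly integrable because its fourth
    moment converges ([amplitude_unif_integrable]); this is contiguity. *)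

(** * Limits of complex numbers and of complex matrices along a filter *)

Section ComplexLimits.
Variables (R : realType) (T : Type) (F : set_system T).
Context {FF : Filter F}.
Implicit Types (u v : T -> R[i]) (l m : R[i]).

(** The filter is arbitrary so that the same expansions serve [n --> oo] with
    the scale [1 / sqrt n] and the derivatives at [theta0], where the scale tends
    to [0] along [0^'].  For [F = \oo] this is [ccvg]. *)
Definition cto u l : Prop :=
  (complex.Re (u t) @[t --> F] --> complex.Re l) /\
  (complex.Im (u t) @[t --> F] --> complex.Im l).

Lemma cReD (x y : R[i]) : complex.Re (x + y) = complex.Re x + complex.Re y.
Proof. by case: x => ? ?; case: y. Qed.
Lemma cImD (x y : R[i]) : complex.Im (x + y) = complex.Im x + complex.Im y.
Proof. by case: x => ? ?; case: y. Qed.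
Lemma cReN (x : R[i]) : complex.Re (- x) = - complex.Re x.
Proof. by case: x. Qed.
Lemma cImN (x : R[i]) : complex.Im (- x) = - complex.Im x.
Proof. by case: x. Qed.
Lemma cReM (x y : R[i]) : complex.Re (x * y) =
  complex.Re x * complex.Re y - complex.Im x * complex.Im y.
Proof. by case: x => ? ?; case: y. Qed.
Lemma cImM (x y : R[i]) : complex.Im (x * y) =
  complex.Re x * complex.Im y + complex.Im x * complex.Re y.
Proof. by case: x => ? ?; case: y. Qed.
Lemma complex_ext (x y : R[i]) : complex.Re x = complex.Re y ->
  complex.Im x = complex.Im y -> x = y.
Proof. by case: x => ? ?; case: y => ? ? /= -> ->. Qed.

Lemma cto_cst l : cto (fun=> l) l.
Proof. by split; exact: cvg_cst. Qed.

Lemma ctoD u v l m : cto u l -> cto v m -> cto (fun t => u t + v t) (l + m).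
Proof.
move=> [ur ui] [vr vi]; split.
  rewrite cReD (_ : (fun t => _) = (fun t => complex.Re (u t) + complex.Re (v t))).
    exact: cvgD.
  by apply/funext => t; rewrite cReD.
rewrite cImD (_ : (fun t => _) = (fun t => complex.Im (u t) + complex.Im (v t))).
  exact: cvgD.
by apply/funext => t; rewrite cImD.
Qed.

Lemma ctoN u l : cto u l -> cto (fun t => - u t) (- l).
Proof.
move=> [ur ui]; split.
  rewrite cReN (_ : (fun t => _) = (fun t => - complex.Re (u t))).
    exact: cvgN.
  by apply/funext => t; rewrite cReN.
rewrite cImN (_ : (fun t => _) = (fun t => - complex.Im (u t))).
  exact: cvgN.
by apply/funext => t; rewrite cImN.
Qed.

Lemma ctoB u v l m : cto u l -> cto v m -> cto (fun t => u t - v t) (l - m).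
Proof. by move=> ul vm; apply: ctoD => //; exact: ctoN. Qed.

Lemma ctoM u v l m : cto u l -> cto v m -> cto (fun t => u t * v t) (l * m).
Proof.
move=> [ur ui] [vr vi]; split.
  rewrite cReM (_ : (fun t => _) = (fun t => complex.Re (u t) * complex.Re (v t)
    - complex.Im (u t) * complex.Im (v t))).
    by apply: cvgB; exact: cvgM.
  by apply/funext => t; rewrite cReM.
rewrite cImM (_ : (fun t => _) = (fun t => complex.Re (u t) * complex.Im (v t)
    + complex.Im (u t) * complex.Re (v t))).
  by apply: cvgD; exact: cvgM.
by apply/funext => t; rewrite cImM.
Qed.

Lemma cto_sum (I : Type) (s : seq I) (P : pred I) (u : I -> T -> R[i])
    (l : I -> R[i]) : (forall i, P i -> cto (u i) (l i)) ->
  cto (fun t => \sum_(i <- s | P i) u i t) (\sum_(i <- s | P i) l i).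
Proof.
move=> ul; elim: s => [|i s IH].
  rewrite (_ : (fun t => _) = fun=> 0); first by rewrite big_nil; exact: cto_cst.
  by apply/funext => t; rewrite big_nil.
rewrite (_ : (fun t => _) = fun t => (if P i then u i t + \sum_(j <- s | P j) u j t
  else \sum_(j <- s | P j) u j t)); last by apply/funext => t; rewrite big_cons.
by rewrite big_cons; case: ifP => // Pi; apply: ctoD => //; exact: ul.
Qed.

Lemma cto_near u v l : (\forall t \near F, u t = v t) -> cto u l -> cto v l.
Proof.
move=> uv [ur ui]; split.
  apply: cvg_trans ur; apply: near_eq_cvg.
  by apply: filterS uv => t /= ->.
apply: cvg_trans ui; apply: near_eq_cvg.
by apply: filterS uv => t /= ->.
Qed.

Lemma cto_conj u l : cto u l -> cto (fun t => (u t)^*) l^*.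
Proof.
have Ec (z : R[i]) : complex.Re z^* = complex.Re z by case: z.
have Ei (z : R[i]) : complex.Im z^* = - complex.Im z by case: z.
move=> [ur ui]; split.
  by rewrite Ec; under eq_fun do rewrite Ec.
by rewrite Ei; under eq_fun do rewrite Ei; exact: cvgN.
Qed.

Lemma cto_real (x : T -> R) (l : R) : x t @[t --> F] --> l ->
  cto (fun t => (x t)%:C) l%:C.
Proof. by move=> xl; split => //=; exact: cvg_cst. Qed.

Lemma cvg0_dominated (x y : T -> R) : (\forall t \near F, `|x t| <= y t) ->
  y t @[t --> F] --> (0 : R) -> x t @[t --> F] --> (0 : R).
Proof.
move=> xy y0; apply/norm_cvg0P.
have B : \forall t \near F, 0 <= `|x t| <= y t.
  by apply: filterS xy => t ->; rewrite normr_ge0.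
exact: (squeeze_cvgr B (cvg_cst 0) y0).
Qed.

Lemma cto_norm0 u : normc (u t) @[t --> F] --> (0 : R) -> cto u 0.
Proof.
have lo (x y : R) : `|x| <= Num.sqrt (x ^+ 2 + y ^+ 2).
  by rewrite -sqrtr_sqr ler_wsqrtr// lerDl sqr_ge0.
move=> u0; split => /=; apply: (cvg0_dominated _ u0); apply: nearW => t.
  by case: (u t) => x y /=; exact: lo.
by case: (u t) => x y /=; rewrite addrC; exact: lo.
Qed.

Lemma norm_cto0 u : cto u 0 -> normc (u t) @[t --> F] --> (0 : R).
Proof.
move=> [/= /cvg_norm + /cvg_norm]; rewrite normr0 => ur ui.
have lo (x y : R) : Num.sqrt (x ^+ 2 + y ^+ 2) <= `|x| + `|y|.
  rewrite -[leRHS]ger0_norm ?addr_ge0// -sqrtr_sqr ler_wsqrtr//.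
  rewrite sqrrD !real_normK ?num_real// lerD2r lerDl.
  by rewrite mulrn_wge0// mulr_ge0.
apply: (@cvg0_dominated _ (fun t => `|complex.Re (u t)| + `|complex.Im (u t)|)).
  apply: nearW => t; case: (u t) => x y /=.
  by rewrite ger0_norm ?sqrtr_ge0.
by rewrite -[0]addr0; exact: cvgD.
Qed.

Implicit Types (p q r : nat).

Definition mto p q (U : T -> 'M[R[i]]_(p, q)) (A : 'M[R[i]]_(p, q)) : Prop :=
  forall a b, cto (fun t => U t a b) (A a b).

Lemma mto_cst p q (A : 'M[R[i]]_(p, q)) : mto (fun=> A) A.
Proof. by move=> a b; exact: cto_cst. Qed.

Lemma mtoD p q (U V : T -> 'M[R[i]]_(p, q)) A B : mto U A -> mto V B ->
  mto (fun t => U t + V t) (A + B).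
Proof.
move=> UA VB a b; rewrite mxE (_ : (fun t => _) = fun t => U t a b + V t a b).
  exact: ctoD.
by apply/funext => t; rewrite mxE.
Qed.

Lemma mtoZ p q (c : T -> R[i]) (U : T -> 'M[R[i]]_(p, q)) l A : cto c l ->
  mto U A -> mto (fun t => c t *: U t) (l *: A).
Proof.
move=> cl UA a b; rewrite mxE (_ : (fun t => _) = fun t => c t * U t a b).
  exact: ctoM.
by apply/funext => t; rewrite mxE.
Qed.

Lemma mtoM p q r (U : T -> 'M[R[i]]_(p, q)) (V : T -> 'M[R[i]]_(q, r)) A B :
  mto U A -> mto V B -> mto (fun t => U t *m V t) (A *m B).
Proof.
move=> UA VB a b; rewrite mxE
  (_ : (fun t => _) = fun t => \sum_j U t a j * V t j b).
  by apply: cto_sum => j _; exact: ctoM.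
by apply/funext => t; rewrite mxE.
Qed.

Lemma mto_tr p (U : T -> 'M[R[i]]_p) A : mto U A ->
  cto (fun t => \tr (U t)) (\tr A).
Proof. by move=> UA; apply: cto_sum => j _. Qed.

Lemma mto_near p q (U V : T -> 'M[R[i]]_(p, q)) A :
  (\forall t \near F, U t = V t) -> mto U A -> mto V A.
Proof. by move=> UV UA a b; apply: cto_near (UA a b); apply: filterS UV => t ->. Qed.

End ComplexLimits.

Lemma cRe_sum (R : realType) (I : Type) (s : seq I) (f : I -> R[i]) :
  complex.Re (\sum_(i <- s) f i) = \sum_(i <- s) complex.Re (f i).
Proof. by apply: (big_morph (@complex.Re R) (@cReD R)). Qed.

Lemma cIm_sum (R : realType) (I : Type) (s : seq I) (f : I -> R[i]) :
  complex.Im (\sum_(i <- s) f i) = \sum_(i <- s) complex.Im (f i).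
Proof. by apply: (big_morph (@complex.Im R) (@cImD R)). Qed.

Lemma Re_le_normc (R : realType) (z : R[i]) : complex.Re z <= normc z.
Proof.
case: z => x y /=; apply: (le_trans (ler_norm _)).
by rewrite -sqrtr_sqr ler_wsqrtr// lerDl sqr_ge0.
Qed.

(** * Second-order expansions and limits of powers *)

Section Taylor.
Variable R : realType.
Implicit Types (f g : R -> R) (a b : R).

Lemma derive_near0 g b : is_derive (0 : R) (1 : R) g b -> forall eps, 0 < eps ->
  exists2 del, 0 < del & forall x, `|x| < del -> `|g x - g 0 - b * x| <= eps * `|x|.
Proof.
move=> [dg <-] eps eps0.
move: dg => /derivable_nbhsP/eqaddoP/(_ _ eps0)/nbhs_ballP[del /= del0 H].
exists del => // x xd; have := H x.
rewrite /ball/= sub0r normrN => /(_ xd).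
by rewrite !fctE /= /shift/= addr0 /cst /GRing.scale/= mulr1 opprD addrA mulrC.
Qed.

Definition second_order f a b : Prop := forall eps, 0 < eps ->
  exists2 del, 0 < del &
    forall x, `|x| < del -> `|f x - f 0 - a * x - b * x ^+ 2| <= eps * x ^+ 2.

(** The remainder has derivative [o(x)], so the mean value theorem makes it
    [o(x^2)]. *)
Lemma second_orderP f f' a b : (forall x, is_derive x (1 : R) f (f' x)) ->
  f' 0 = a -> is_derive (0 : R) (1 : R) f' (2 * b) -> second_order f a b.
Proof.
move=> df f'0 df' eps eps0.
have [del del0 H] := derive_near0 df' eps0; exists del => // x xd.
pose g y := f y - f 0 - a * y - b * y ^+ 2.
pose g' y := f' y - f' 0 - 2 * b * y.
have dg y : is_derive y (1 : R) g (g' y).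
  have -> : g = f - cst (f 0) - a \*: id - b \*: (id ^+ 2).
    by apply/funext => z; rewrite /g !fctE.
  have dfy := df y.
  apply: is_derive_eq; rewrite /g' f'0 /GRing.scale/= expr1.
  ring.
have cg (u v : R) : {within `[u, v], continuous g}.
  apply: continuous_subspaceT => z.
  have [dz _] := dg z.
  by apply: differentiable_continuous; apply/derivable1_diffP.
have g0 : g 0 = 0 by rewrite /g; ring.
have bnd c : `|c| <= `|x| -> `|g' c * x| <= eps * x ^+ 2.
  move=> cx; rewrite normrM -[x ^+ 2]real_normK ?num_real// expr2 mulrA.
  rewrite ler_wpM2r//; apply: (le_trans (H c (le_lt_trans cx xd))).
  by rewrite ler_wpM2l// ltW.
have [x0|x0] := leP 0 x.
  have [c] := MVT_segment x0 (fun z _ => dg z) (@cg _ _).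
  rewrite g0 !subr0 in_itv/= => /andP[c0 cx] E; rewrite -/(g x) E bnd//.
  by rewrite !ger0_norm.
have [c] := MVT_segment (ltW x0) (fun z _ => dg z) (@cg _ _).
rewrite g0 !sub0r in_itv/= => /andP[c0 cx] E.
have -> : f x - f 0 - a * x - b * x ^+ 2 = g' c * x.
  by rewrite -/(g x) -[g x]opprK E mulrN opprK.
by rewrite bnd// ler0_norm// ler0_norm ?lerN2// ltW.
Qed.

Lemma second_order_expR : second_order expR 1 2^-1.
Proof.
apply: (second_orderP (f' := expR)); first by rewrite expR0.
by rewrite divff//; apply: is_derive_eq (is_derive_expR 0) _; rewrite expR0.
Qed.

Lemma second_order_cos : second_order cos 0 (- 2^-1).
Proof.
apply: (second_orderP (f' := fun x => - sin x)); first by rewrite sin0 oppr0.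
have -> : (fun x : R => - sin x) = - sin by [].
by apply: is_derive_eq; rewrite cos0 mulrN divff.
Qed.

Lemma second_order_sin : second_order sin 1 0.
Proof.
apply: (second_orderP (f' := cos)); first by rewrite cos0.
by apply: is_derive_eq; rewrite sin0 mulr0 oppr0.
Qed.

Variables (T : Type) (F : set_system T).
Context {FF : Filter F}.
Variable e : T -> R.
Hypothesis e0 : e t @[t --> F] --> (0 : R).
Hypothesis en0 : \forall t \near F, e t != 0.

Lemma second_order_cvg f a b (x : R) : second_order f a b ->
  (e t)^-1 ^+ 2 * (f (e t * x) - f 0 - a * (e t * x)) @[t --> F] --> b * x ^+ 2.
Proof.
move=> sf; apply/cvgrPdist_le => eps eps0.
(* [1 + x^2] rather than [x^2], since [x] may vanish *)
pose eta := eps / (1 + x ^+ 2).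
have x21 : 0 < 1 + x ^+ 2 by rewrite ltr_pwDl// sqr_ge0.
have eta0 : 0 < eta by rewrite divr_gt0.
have [del del0 H] := sf _ eta0.
have ex0 : e t * x @[t --> F] --> (0 : R) by rewrite -(mul0r x); apply: cvgMl.
near=> t.
have et0 : e t != 0 by near: t.
have etx : `|e t * x| < del by near: t; apply: cvgr0_norm_lt ex0 _ del0.
have -> : b * x ^+ 2 - (e t)^-1 ^+ 2 * (f (e t * x) - f 0 - a * (e t * x)) =
  - ((e t)^-1 ^+ 2 * (f (e t * x) - f 0 - a * (e t * x) - b * (e t * x) ^+ 2)).
  by field.
rewrite normrN normrM ger0_norm ?sqr_ge0//.
apply: (@le_trans _ _ ((e t)^-1 ^+ 2 * (eta * (e t * x) ^+ 2))).
  by rewrite ler_wpM2l ?sqr_ge0// H.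
have -> : (e t)^-1 ^+ 2 * (eta * (e t * x) ^+ 2) = eta * x ^+ 2 by field.
by rewrite /eta mulrAC ler_pdivrMr// ler_wpM2l ?(ltW eps0)// lerDr.
Unshelve. all: by end_near. Qed.

Lemma second_order_slope f a b (x : R) : second_order f a b ->
  (e t)^-1 * (f (e t * x) - f 0) @[t --> F] --> a * x.
Proof.
move=> /(@second_order_cvg f a b x) H.
have : e t * ((e t)^-1 ^+ 2 * (f (e t * x) - f 0 - a * (e t * x))) + a * x
    @[t --> F] --> 0 * (b * x ^+ 2) + a * x.
  by apply: cvgD; [apply: cvgM|exact: cvg_cst].
rewrite mul0r add0r; apply: cvg_trans; apply: near_eq_cvg.
near=> t; have et0 : e t != 0 by near: t.
by field.
Unshelve. all: by end_near. Qed.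

End Taylor.

Section ComplexTaylor.
Variables (R : realType) (T : Type) (F : set_system T).
Context {FF : Filter F}.
Variable e : T -> R.
Hypothesis e0 : e t @[t --> F] --> (0 : R).
Hypothesis en0 : \forall t \near F, e t != 0.

Definition csecond_order (f : R -> R[i]) (a b : R[i]) : Prop :=
  second_order (fun x => complex.Re (f x)) (complex.Re a) (complex.Re b) /\
  second_order (fun x => complex.Im (f x)) (complex.Im a) (complex.Im b).

Lemma csecond_order_cvg (f : R -> R[i]) (a b : R[i]) (x : R) :
  csecond_order f a b ->
  cto F (fun t => ((e t)^-1 ^+ 2)%:C * (f (e t * x) - f 0 - a * (e t * x)%:C))
    (b * (x ^+ 2)%:C).
Proof.
move=> [fr fi]; split.
  rewrite cReM/= mulr0 subr0.
  under eq_fun do rewrite cReM/= !cReD !cReN cReM/= mul0r mulr0 !subr0.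
  exact: (second_order_cvg e0 en0 fr).
rewrite cImM/= mulr0 add0r.
under eq_fun do rewrite cImM/= !cImD !cImN cImM/= mul0r mulr0 addr0 add0r.
exact: (second_order_cvg e0 en0 fi).
Qed.

End ComplexTaylor.

Section Powers.
Variable R : realType.
Implicit Types (u v : nat -> R[i]) (z w : R[i]).

Lemma csecond_order_exp : csecond_order (fun x : R => (expR x)%:C) 1 2^-1.
Proof.
have -> : 2^-1 = (2^-1 : R)%:C by rewrite fmorphV rmorphMn.
split => /=; first exact: second_order_expR.
by move=> eps eps0; exists 1 => // x _; rewrite !mul0r !subr0 normr0 mulr_ge0 ?sqr_ge0// ltW.
Qed.

Lemma csecond_order_expi : csecond_order (fun x : R => cos x +i* sin x) 'i (- 2^-1).
Proof.
have -> : - 2^-1 = (- 2^-1 : R)%:C by rewrite rmorphN fmorphV rmorphMn.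
split => /=; first exact: second_order_cos.
exact: second_order_sin.
Qed.

Lemma cexpD z w : cexp (z + w) = cexp z * cexp w.
Proof.
rewrite /cexp cReD cImD expRD cosD sinD.
by apply: complex_ext; rewrite !(cReM, cImM)/=; ring.
Qed.

Lemma cexp0 : cexp (0 : R[i]) = 1.
Proof. by rewrite /cexp/= expR0 cos0 sin0 mul1r. Qed.

Lemma cexpMn z n : cexp (n%:R * z) = cexp z ^+ n.
Proof.
elim: n => [|n IH]; first by rewrite mul0r cexp0 expr0.
by rewrite exprS -IH -cexpD -natr1 mulrDl mul1r addrC.
Qed.

Lemma cexp_real (x : R) : cexp x%:C = (expR x)%:C.
Proof. by rewrite /cexp/= cos0 sin0 mulr1. Qed.

Lemma invn_cvg0 : (n%:R^-1 : R) @[n --> \oo] --> (0 : R).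
Proof.
rewrite -cvg_shiftS; exact: cvg_harmonic.
Qed.

Lemma invn_neq0 : \forall n \near \oo, n%:R^-1 != 0 :> R.
Proof. by exists 1%N => // n /= n0; rewrite invr_eq0 pnatr_eq0 -lt0n. Qed.

Lemma cexp_slope z : cto \oo (fun n => (n%:R : R)%:C * (cexp ((n%:R^-1 : R)%:C * z) - 1)) z.
Proof.
case: z => x y.
have X : cto \oo (fun n => (n%:R * (expR (n%:R^-1 * x) - 1))%:C) x%:C.
  apply: cto_real.
  have := second_order_slope (FF := eventually_filter) invn_cvg0 invn_neq0 (x := x) (@second_order_expR R).
  by rewrite expR0 mul1r; under eq_fun do rewrite invrK.
have Y : cto \oo (fun n => (n%:R * (cos (n%:R^-1 * y) - 1))%:C
    + (n%:R * sin (n%:R^-1 * y))%:C * 'i) (0%:C + y%:C * 'i).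
  apply: ctoD.
    apply: cto_real.
    have := second_order_slope (FF := eventually_filter) invn_cvg0 invn_neq0 (x := y) (@second_order_cos R).
    by rewrite cos0 mul0r; under eq_fun do rewrite invrK.
  apply: ctoM; last exact: cto_cst.
  apply: cto_real.
  have := second_order_slope (FF := eventually_filter) invn_cvg0 invn_neq0 (x := y) (@second_order_sin R).
  by rewrite sin0 mul1r; under eq_fun do rewrite invrK subr0.
have Z : cto \oo (fun n : nat => (expR (n%:R^-1 * x))%:C) (expR 0)%:C.
  apply: cto_real; apply: continuous_cvg; first exact: continuous_expR.
  by rewrite -(mul0r x); apply: cvgMl; exact: invn_cvg0.
pose proof (ctoD X (ctoM Z Y)) as H; move: H.
have -> : x%:C + (expR 0)%:C * (0%:C + y%:C * 'i) = x +i* y.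
  by rewrite expR0; apply: complex_ext; rewrite !(cReD, cImD, cReM, cImM)/=; ring.
move=> H; apply: cto_near H; apply: nearW => n.
have -> : (n%:R^-1 : R)%:C * (x +i* y) = (n%:R^-1 * x) +i* (n%:R^-1 * y).
  by apply: complex_ext; rewrite !(cReM, cImM)/=; ring.
by rewrite /cexp/=; apply: complex_ext; rewrite !(cReD, cImD, cReN, cImN, cReM, cImM)/=; ring.
Qed.

Lemma normcX z n : normc (z ^+ n) = normc z ^+ n.
Proof.
elim: n => [|n IH]; first by rewrite !expr0 /= expr1n expr0n/= addr0 sqrtr1.
by rewrite !exprS normcM IH.
Qed.

Lemma normc_ge0 z : 0 <= normc z.
Proof. by case: z => x y /=; rewrite sqrtr_ge0. Qed.

Lemma normc_nat n : normc (n%:R : R)%:C = n%:R.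
Proof. by rewrite /= expr0n/= addr0 sqrtr_sqr ger0_norm. Qed.

(** By induction, from
    [z^(n+1) - w^(n+1) = z^n (z - w) + (z^n - w^n) w]. *)
Lemma normc_subX (M : R) z w n : normc z <= M -> normc w <= M -> 1 <= M ->
  normc (z ^+ n - w ^+ n) <= n%:R * M ^+ n * normc (z - w).
Proof.
move=> zM wM M1; have M0 : 0 <= M by exact: le_trans M1.
elim: n => [|n IH]; first by rewrite !expr0 subrr !mul0r normc0.
have -> : z ^+ n.+1 - w ^+ n.+1 = z ^+ n * (z - w) + (z ^+ n - w ^+ n) * w.
  by rewrite !exprSr; ring.
apply: (le_trans (le_normcD _ _)); rewrite !normcM normcX.
have -> : n.+1%:R * M ^+ n.+1 * normc (z - w) =
    M * M ^+ n * normc (z - w) + (n%:R * M ^+ n * normc (z - w)) * M.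
  by rewrite exprS -natr1; ring.
apply: lerD; last by apply: ler_pM => //; exact: normc_ge0.
rewrite ler_wpM2r ?normc_ge0//.
have : normc z ^+ n <= M ^+ n by rewrite lerXn2r ?nnegrE ?normc_ge0.
by move/le_trans; apply; rewrite ler_peMl// exprn_ge0.
Qed.

(** Keeps the powers of [u n] bounded. *)
Lemma normc_le_exp u z : cto \oo (fun n => (n%:R : R)%:C * (u n - 1)) z ->
  exists2 c, 0 <= c & \forall n \near \oo, normc (u n) <= expR (c / n%:R).
Proof.
move=> uz; exists (normc z + 1); first by rewrite addr_ge0 ?normc_ge0.
have uz0 : cto \oo (fun n => (n%:R : R)%:C * (u n - 1) - z) 0.
  by rewrite -(subrr z); apply: ctoB => //; exact: cto_cst.
have uz1 : \forall n \near \oo, `|normc ((n%:R : R)%:C * (u n - 1) - z)| < 1.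
  by apply: cvgr0_norm_lt (norm_cto0 uz0) _ ltr01.
apply: filter_app uz1.
exists 1%N => // n /= n0; rewrite ger0_norm ?normc_ge0// => H.
have n0' : 0 < n%:R :> R by rewrite ltr0n.
have B : normc (u n - 1) <= (normc z + 1) / n%:R.
  rewrite ler_pdivlMr// mulrC -(normc_nat n) -normcM.
  rewrite -[_ * _](subrK z) addrC; apply: (le_trans (le_normcD _ _)).
  by rewrite lerD2l ltW.
rewrite -[u n](subrK 1) addrC; apply: (le_trans (le_normcD _ _)).
by rewrite normc1; apply: (le_trans _ (expR_ge1Dx _)); rewrite lerD2l.
Qed.

(** Compare with [cexp (z / n) ^+ n = cexp z]: the two bases differ by [o(1/n)],
    and by [normc_subX] the powers differ by at most [n expR (c + d)] times that. *)
Lemma cto_expn u z : cto \oo (fun n => (n%:R : R)%:C * (u n - 1)) z ->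
  cto \oo (fun n => u n ^+ n) (cexp z).
Proof.
move=> uz; pose v n := cexp ((n%:R^-1 : R)%:C * z).
have vz : cto \oo (fun n => (n%:R : R)%:C * (v n - 1)) z := cexp_slope z.
have [c c0 uc] := normc_le_exp uz; have [d d0 vd] := normc_le_exp vz.
suff H : cto \oo (fun n => u n ^+ n - v n ^+ n) 0.
  pose proof (ctoD H (@cto_cst _ _ \oo _ (cexp z))) as H1; move: H1; rewrite add0r.
  move=> H1; apply: cto_near H1; exists 1%N => // n /= n0.
  rewrite /v -cexpMn mulrA.
  have -> : (n%:R : R[i]) * (n%:R^-1 : R)%:C = 1.
    by rewrite fmorphV rmorph_nat divff// pnatr_eq0 -lt0n.
  by rewrite mul1r subrK.
have W : cto \oo (fun n => (n%:R : R)%:C * (u n - 1) - (n%:R : R)%:C * (v n - 1)) 0.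
  by rewrite -(subrr z); apply: ctoB.
apply: cto_norm0.
apply: (@cvg0_dominated _ _ _ _ _ (fun n => expR (c + d) *
  normc ((n%:R : R)%:C * (u n - 1) - (n%:R : R)%:C * (v n - 1)))); last first.
  by rewrite -(mulr0 (expR (c + d))); apply: cvgMr; exact: norm_cto0 W.
near=> n.
have n0 : (0 < n)%N by near: n; exists 1%N.
have n0' : 0 < n%:R :> R by rewrite ltr0n.
rewrite ger0_norm ?normc_ge0// -mulrBr normcM normc_nat.
have -> : u n - 1 - (v n - 1) = u n - v n by ring.
rewrite mulrA [_ * n%:R]mulrC.
have E : expR (c + d) = expR ((c + d) / n%:R) ^+ n.
  by rewrite -expRM_natl mulrC divfK// gt_eqF.
rewrite E; apply: normc_subX.
- apply: (le_trans (_ : _ <= expR (c / n%:R))); first by near: n.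
  by rewrite ler_expR ler_wpM2r ?invr_ge0// lerDl.
- apply: (le_trans (_ : _ <= expR (d / n%:R))); first by near: n.
  by rewrite ler_expR ler_wpM2r ?invr_ge0// lerDr.
- by rewrite -expR0 ler_expR divr_ge0// addr_ge0.
Unshelve. all: by end_near. Qed.

(** The local scale [h / sqrt n] of the parameter. *)
Definition rt (n : nat) : R := (Num.sqrt n%:R)^-1.

Lemma rt_cvg0 : rt n @[n --> \oo] --> (0 : R).
Proof.
have -> : (fun n => rt n) = (fun n : nat => Num.sqrt (n%:R^-1 : R)).
  by apply/funext => n; rewrite sqrtrV.
rewrite -sqrtr0; apply: continuous_cvg; first exact: sqrt_continuous.
exact: invn_cvg0.
Qed.

Lemma rt_neq0 : \forall n \near \oo, rt n != 0.
Proof. by exists 1%N => // n /= n0; rewrite invr_eq0 sqrtr_eq0 -ltNge ltr0n. Qed.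

Lemma rtE n : (rt n)^-1 ^+ 2 = n%:R.
Proof. by rewrite invrK sqr_sqrtr. Qed.

End Powers.

(** * Adjoints and positive semidefinite matrices *)

Lemma mxtraceB (K : comNzRingType) n (A B : 'M[K]_n) : \tr (A - B) = \tr A - \tr B.
Proof. exact: raddfB. Qed.

Lemma mxtrace_sum (K : comNzRingType) n (I : Type) (s : seq I) (P : pred I)
    (A : I -> 'M[K]_n) : \tr (\sum_(i <- s | P i) A i) = \sum_(i <- s | P i) \tr (A i).
Proof. exact: raddf_sum. Qed.

Lemma mulmx_subsub (K : comNzRingType) n (P X Y : 'M[K]_n) :
  P *m ((X - Y) *m (X - Y)) = P *m (X *m X) - P *m (X *m Y) - P *m (Y *m X) + P *m (Y *m Y).
Proof. by rewrite mulmxBl !mulmxBr opprD opprK !addrA. Qed.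

Section Adjoint.
Variable R : realType.
Local Notation C := R[i].

Lemma hadjE m n (A : 'M[C]_(m, n)) a b : A^t* a b = (A b a)^*.
Proof. by rewrite !mxE. Qed.

Lemma hadjM m n p (A : 'M[C]_(m, n)) (B : 'M[C]_(n, p)) :
  (A *m B)^t* = B^t* *m A^t*.
Proof. by rewrite trmx_mul map_mxM. Qed.

Lemma hadjD m n (A B : 'M[C]_(m, n)) : (A + B)^t* = A^t* + B^t*.
Proof. by apply/matrixP => a b; rewrite !mxE rmorphD. Qed.

Lemma hadjB m n (A B : 'M[C]_(m, n)) : (A - B)^t* = A^t* - B^t*.
Proof. by apply/matrixP => a b; rewrite !mxE rmorphB. Qed.

Lemma hadjZ m n c (A : 'M[C]_(m, n)) : (c *: A)^t* = c^* *: A^t*.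
Proof. by apply/matrixP => a b; rewrite !mxE rmorphM. Qed.

Lemma hadj1 n : (1%:M : 'M[C]_n)^t* = 1%:M.
Proof. by rewrite trmx1 map_mx1. Qed.

Lemma hadj0 m n : (0 : 'M[C]_(m, n))^t* = 0.
Proof. by apply/matrixP => a b; rewrite !mxE rmorph0. Qed.

Lemma mxtrace_adj n (A : 'M[C]_n) : \tr (A^t*) = (\tr A)^*.
Proof. by rewrite [in RHS]/mxtrace rmorph_sum; apply: eq_bigr => a _; rewrite hadjE. Qed.

Lemma hermE n (A : 'M[C]_n) : A \is hermsymmx <-> A^t* = A.
Proof.
split=> [/is_hermitianmxP|AA]; first by rewrite expr0 scale1r => <-.
by apply/is_hermitianmxP; rewrite expr0 scale1r AA.
Qed.

Lemma hermD n (A B : 'M[C]_n) : A \is hermsymmx -> B \is hermsymmx ->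
  A + B \is hermsymmx.
Proof. by move=> /hermE hA /hermE hB; apply/hermE; rewrite hadjD hA hB. Qed.

Lemma hermB n (A B : 'M[C]_n) : A \is hermsymmx -> B \is hermsymmx ->
  A - B \is hermsymmx.
Proof. by move=> /hermE hA /hermE hB; apply/hermE; rewrite hadjB hA hB. Qed.

Lemma herm0 n : (0 : 'M[C]_n) \is hermsymmx.
Proof. by apply/hermE/matrixP => a b; rewrite !mxE rmorph0. Qed.

Lemma hermZ n (c : R) (A : 'M[C]_n) : A \is hermsymmx -> c%:C *: A \is hermsymmx.
Proof. by move=> /hermE hA; apply/hermE; rewrite hadjZ hA; congr (_ *: _); exact: conjc_real. Qed.

Lemma herm_sum n (I : Type) (s : seq I) (P : pred I) (A : I -> 'M[C]_n) :
  (forall i, P i -> A i \is hermsymmx) -> \sum_(i <- s | P i) A i \is hermsymmx.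
Proof. by move=> hA; elim/big_rec: _ => [|i B Pi hB]; [exact: herm0|apply: hermD; [exact: hA|]]. Qed.

(** The eigenvalues are written as casts of their real parts because [hfun] only
    sees the real parts. *)
Lemma herm_spectral n (A : 'M[C]_n) : A \is hermsymmx ->
  A = invmx (spectralmx A) *m
      diag_mx (map_mx (fun z => (complex.Re z)%:C) (spectral_diag A)) *m spectralmx A.
Proof.
move=> hA; have /orthomx_spectralP E := hermitian_normalmx hA.
suff -> : map_mx (fun z => (complex.Re z)%:C) (spectral_diag A) = spectral_diag A.
  exact: E.
apply/matrixP => a b; rewrite mxE; apply: RRe_real.
by have /mxOverP := hermitian_spectral_diag_real hA; apply.
Qed.

Lemma tr_gram m n (G : 'M[C]_(m, n)) : \tr (G^t* *m G) = \sum_b \sum_a `|G a b| ^+ 2.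
Proof.
apply: eq_bigr => b _; rewrite mxE; apply: eq_bigr => a _.
by rewrite hadjE mulrC -sqr_normc.
Qed.

Lemma tr_gram_ge0 m n (G : 'M[C]_(m, n)) : 0 <= \tr (G^t* *m G).
Proof. by rewrite tr_gram !sumr_ge0// => b _; rewrite sumr_ge0// => a _; rewrite exprn_ge0. Qed.

Lemma tr_gram_eq0 m n (G : 'M[C]_(m, n)) : \tr (G^t* *m G) = 0 -> G = 0.
Proof.
rewrite tr_gram => /eqP; rewrite psumr_eq0; last first.
  by move=> b _; rewrite sumr_ge0// => a _; rewrite exprn_ge0.
move=> /allP H; apply/matrixP => a b; rewrite mxE.
have := H b (mem_index_enum _); rewrite implyTb psumr_eq0; last first.
  by move=> i _; rewrite exprn_ge0.
move=> /allP/(_ a (mem_index_enum _)).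
by rewrite implyTb expf_eq0/= normr_eq0 => /eqP.
Qed.

Lemma gram_eq0 m n (G : 'M[C]_(m, n)) : G^t* *m G = 0 -> G = 0.
Proof. by move=> E; apply: tr_gram_eq0; rewrite E mxtrace0. Qed.

Lemma quad_gram m n (G : 'M[C]_(m, n)) (v : 'cV[C]_n) :
  0 <= (v^t* *m (G^t* *m G) *m v) 0 0.
Proof.
have -> : v^t* *m (G^t* *m G) *m v = (G *m v)^t* *m (G *m v) by rewrite hadjM !mulmxA.
by have := tr_gram_ge0 (G *m v); rewrite trace_mx11.
Qed.

Lemma psd_gram m n (G : 'M[C]_(m, n)) : psd (G^t* *m G).
Proof.
split; last exact: quad_gram.
by apply/hermE; rewrite hadjM trmxCK.
Qed.

(** A Gram factor turns the facts below on kernels, congruences and traces into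
    the remark that [G^t* G = 0] forces [G = 0]. *)
Lemma psd_factor n (A : 'M[C]_n) : psd A -> exists G : 'M[C]_n, A = G^t* *m G.
Proof.
move=> [hA pA]; set S := spectralmx A.
have uS : S \is unitarymx by exact: spectral_unitarymx.
have E := orthomx_spectralP (hermitian_normalmx hA); rewrite -/S invmx_unitary// in E.
set mu := spectral_diag A in E.
have mu_ge0 j : 0 <= mu 0 j.
  have := pA (S^t* *m delta_mx j 0); rewrite E hadjM trmxCK !mulmxA !mulmxtVK//.
  rewrite mul_mx_diag mxE (bigD1 j)//= big1 ?addr0 => [|k kj]; last first.
    by rewrite !mxE (negbTE kj)/= mulr0.
  by rewrite !mxE !eqxx rmorph1 mul1r mulr1.
exists (diag_mx (map_mx sqrtC mu) *m S).
have D : (diag_mx (map_mx sqrtC mu))^t* *m diag_mx (map_mx sqrtC mu) = diag_mx mu.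
  rewrite tr_diag_mx map_diag_mx mulmx_diag; congr diag_mx.
  apply/rowP => j; rewrite !mxE.
  transitivity (sqrtC (mu 0 j) * sqrtC (mu 0 j)); last by rewrite -expr2 sqrtCK.
  by congr (_ * _); apply/CrealP; rewrite ger0_real// sqrtC_ge0.
by rewrite hadjM mulmxA -(mulmxA (S^t*)) D.
Qed.

Lemma psd_herm n (A : 'M[C]_n) : psd A -> A^t* = A.
Proof. by move=> [/hermE]. Qed.

Lemma psdD n (A B : 'M[C]_n) : psd A -> psd B -> psd (A + B).
Proof.
move=> [hA pA] [hB pB]; split; first exact: hermD.
by move=> v; rewrite mulmxDr mulmxDl mxE addr_ge0.
Qed.

Lemma psd0 n : psd (0 : 'M[C]_n).
Proof. by split; [exact: herm0|move=> v; rewrite mulmx0 mul0mx mxE]. Qed.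

Lemma psd1 n : psd (1%:M : 'M[C]_n).
Proof. by rewrite -(mulmx1 1%:M) -[X in X *m _]hadj1; exact: psd_gram. Qed.

Lemma psd_conj m n (A : 'M[C]_m) (X : 'M[C]_(m, n)) : psd A -> psd (X^t* *m A *m X).
Proof.
move=> /psd_factor[G ->].
have -> : X^t* *m (G^t* *m G) *m X = (G *m X)^t* *m (G *m X) by rewrite hadjM !mulmxA.
exact: psd_gram.
Qed.

Lemma psd_ker n p (A : 'M[C]_n) (X : 'M[C]_(n, p)) : psd A ->
  X^t* *m A *m X = 0 -> A *m X = 0.
Proof.
move=> /psd_factor[G ->] E.
suff -> : G^t* *m G *m X = G^t* *m (G *m X).
  by rewrite (@gram_eq0 _ _ (G *m X)) ?mulmx0// hadjM -E !mulmxA.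
by rewrite mulmxA.
Qed.

Lemma psd_tr_ge0 n (A : 'M[C]_n) : psd A -> 0 <= \tr A.
Proof. by move=> /psd_factor[G ->]; exact: tr_gram_ge0. Qed.

Lemma tr_gramM n (G H : 'M[C]_n) :
  \tr (G^t* *m G *m (H^t* *m H)) = \tr ((G *m H^t*)^t* *m (G *m H^t*)).
Proof. by rewrite hadjM trmxCK mulmxA mxtrace_mulC !mulmxA. Qed.

Lemma psd_trM_ge0 n (A B : 'M[C]_n) : psd A -> psd B -> 0 <= \tr (A *m B).
Proof.
by move=> /psd_factor[G ->] /psd_factor[H ->]; rewrite tr_gramM tr_gram_ge0.
Qed.

Lemma psd_trM_eq0 n (A B : 'M[C]_n) : psd A -> psd B -> \tr (A *m B) = 0 ->
  A *m B = 0.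
Proof.
move=> /psd_factor[G ->] /psd_factor[H ->]; rewrite tr_gramM => /tr_gram_eq0 E.
by rewrite mulmxA -[_ *m G *m _]mulmxA E mulmx0 mul0mx.
Qed.

Lemma psdD_ker n p (A B : 'M[C]_n) (X : 'M[C]_(n, p)) : psd A -> psd B ->
  X^t* *m (A + B) *m X = 0 -> A *m X = 0 /\ B *m X = 0.
Proof.
move=> pA pB; rewrite mulmxDr mulmxDl => E.
have tA := psd_tr_ge0 (psd_conj X pA); have tB := psd_tr_ge0 (psd_conj X pB).
have : \tr (X^t* *m A *m X) + \tr (X^t* *m B *m X) == 0.
  by rewrite -mxtraceD E mxtrace0.
rewrite paddr_eq0// => /andP[/eqP tA0 /eqP tB0].
have pX (D : 'M[C]_n) : psd D -> \tr (X^t* *m D *m X) = 0 -> D *m X = 0.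
  move=> /psd_factor[G ->] t0.
  rewrite -mulmxA (@tr_gram_eq0 _ _ (G *m X)) ?mulmx0//.
  by rewrite hadjM !mulmxA -t0 !mulmxA.
by split; apply: pX.
Qed.

(** [|A_ab| <= (A_aa + A_bb) / 2] for a Gram matrix; used to turn a bound on the
    trace of the singular part into a bound on its entries. *)
Lemma psd_entry n (A : 'M[C]_n) a b : psd A -> normc (A a b) <= complex.Re (\tr A).
Proof.
move=> /psd_factor[G ->]; rewrite -lecR.
have -> : (complex.Re (\tr (G^t* *m G)))%:C = \tr (G^t* *m G).
  by apply: RRe_real; rewrite ger0_real// tr_gram_ge0.
have -> : (normc ((G^t* *m G) a b))%:C = `|(G^t* *m G) a b|.
  by rewrite normc_def; case: (_ a b).
rewrite tr_gram mxE; apply: (le_trans (ler_norm_sum _ _ _)).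
rewrite exchange_big /=; apply: ler_sum => k _.
rewrite hadjE normrM norm_conjC.
have [->|ab] := eqVneq a b.
  rewrite -expr2 (bigD1 b)//= lerDl sumr_ge0// => j _; exact: exprn_ge0.
rewrite (bigD1 a)//= (bigD1 b)//=; last by rewrite eq_sym.
rewrite addrA; apply: (@le_trans _ _ (`|G k a| ^+ 2 + `|G k b| ^+ 2)); last first.
  by rewrite lerDl sumr_ge0// => j _; exact: exprn_ge0.
have : 0 <= (`|G k a| - `|G k b|) ^+ 2.
  by rewrite real_exprn_even_ge0// rpredB// normr_real.
rewrite sqrrB -mulr_natr => H.
have H2 : 0 <= `|G k a| * `|G k b| by rewrite mulr_ge0.
rewrite -subr_ge0; apply: le_trans (addr_ge0 H H2) _.
by rewrite le_eqVlt; apply/orP; left; apply/eqP; ring.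
Qed.

End Adjoint.

(** * Versions of the square-root likelihood ratio *)

Section LikelihoodRatio.
Variables (R : realType) (D : nat).
Local Notation C := R[i].
Implicit Types (rho sigma A B : 'M[C]_D).

Lemma in_supp_col rho a : psd rho -> in_supp rho (col a rho).
Proof.
move=> /psd_herm hr u ru.
have : u^t* *m rho = 0 by rewrite -hr -hadjM ru hadj0.
by rewrite colE mulmxA => ->; rewrite mul0mx.
Qed.

(** For positive operators, singularity means that the product vanishes: if the
    compression of [rho] to the support of [tau] is zero, then [rho tau = 0] by
    positivity of [rho]. This form passes directly to tensor powers. *)
Lemma sqrt_lrP sigma rho A : psd rho ->
  sqrt_lr sigma rho A <->
  [/\ psd A, psd (sigma - A *m rho *m A) & (sigma - A *m rho *m A) *m rho = 0].
Proof.
move=> pr; split.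
  move=> [pA [tau [pt st E]]]; rewrite E addrC addrA addNr add0r; split=> //.
  have : rho *m tau = 0.
    apply: psd_ker => //; apply/matrixP => a b.
    have := st _ _ (in_supp_col a pt) (in_supp_col b pt).
    rewrite [col b tau]colE [col a tau]colE hadjM => /matrixP/(_ 0 0).
    rewrite trmx_delta map_delta_mx -!mulmxA -rowE mxE !mulmxA -colE mxE => ->.
    by rewrite !mxE.
  by move=> /(congr1 (fun X => X^t* )); rewrite hadjM (psd_herm pr) (psd_herm pt) hadj0.
move=> [pA pt t0]; split=> //; exists (sigma - A *m rho *m A); split=> //.
  move=> u v _ vs.
  have /vs : (sigma - A *m rho *m A) *m (rho *m u) = 0 by rewrite mulmxA t0 mul0mx.
  by rewrite hadjM (psd_herm pr).
by rewrite addrC subrK.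
Qed.

(** With [K = A - B] and [M = A + B], the hypotheses give
    [KrMr + MrKr = 2 (ArAr - BrBr) = 0] for [r = rho], so [\tr (KrMrKr) = 0], a
    trace of a product of positive operators; positivity then forces first
    [rKr = 0] and next [Kr = 0]. No more than [A rho] is determined: the block of
    [A] on the kernel of [rho] is only constrained by positivity. *)
Lemma sqrt_lr_uniq sigma rho A B : psd rho ->
  sqrt_lr sigma rho A -> sqrt_lr sigma rho B -> A *m rho = B *m rho.
Proof.
move=> pr /(sqrt_lrP _ _ pr)[pA _ rA] /(sqrt_lrP _ _ pr)[pB _ rB].
have E : A *m rho *m A *m rho = B *m rho *m B *m rho.
  move: rA rB; rewrite !mulmxBl => /eqP; rewrite subr_eq0 => /eqP <-.
  by move=> /eqP; rewrite subr_eq0 => /eqP <-.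
have hr := psd_herm pr.
pose K := A - B; have hK : K^t* = K by rewrite hadjB (psd_herm pA) (psd_herm pB).
have pM : psd (A + B) by exact: psdD.
have KM : K *m rho *m (A + B) *m rho + (A + B) *m rho *m K *m rho = 0.
  rewrite /K !(mulmxDl, mulmxDr, mulmxN, mulNmx) E.
  move: (B *m rho *m B *m rho) (B *m rho *m A *m rho) (A *m rho *m B *m rho) => w x y.
  by apply/matrixP => a b; rewrite !mxE; ring.
have t0 : \tr (K *m rho *m (A + B) *m rho *m K *m rho) = 0.
  have : \tr (K *m rho *m (K *m rho *m (A + B) *m rho + (A + B) *m rho *m K *m rho)) = 0.
    by rewrite KM mulmx0 mxtrace0.
  rewrite mulmxDr mxtraceD [X in X + _]mxtrace_mulC !mulmxA.
  have -> : \tr (K *m rho *m (A + B) *m rho *m K *m rho) +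
      \tr (K *m rho *m (A + B) *m rho *m K *m rho) =
      2 * \tr (K *m rho *m (A + B) *m rho *m K *m rho) by ring.
  by move=> /eqP; rewrite mulf_eq0 pnatr_eq0/= => /eqP.
have Z : K *m rho *m (A + B) *m rho *m K *m rho = 0.
  suff pY : psd (K *m rho *m (A + B) *m rho *m K) by exact: psd_trM_eq0 pY pr t0.
  have -> : K *m rho *m (A + B) *m rho *m K = (rho *m K)^t* *m (A + B) *m (rho *m K).
    by rewrite hadjM hK hr !mulmxA.
  exact: psd_conj.
have [A0 B0] : A *m (rho *m K *m rho) = 0 /\ B *m (rho *m K *m rho) = 0.
  apply: (psdD_ker pA pB).
  have -> : (rho *m K *m rho)^t* *m (A + B) *m (rho *m K *m rho) =
      rho *m (K *m rho *m (A + B) *m rho *m K *m rho).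
    by rewrite hadjM hadjM hK hr !mulmxA.
  by rewrite Z mulmx0.
have rKr : rho *m K *m rho = 0.
  rewrite -mulmxA; apply: (psd_ker pr); rewrite hadjM hr hK -!mulmxA.
  suff -> : K *m (rho *m (K *m rho)) = 0 by rewrite mulmx0.
  by rewrite {1}/K mulmxBl (mulmxA rho) A0 B0 subrr.
have rAB : rho *m (A *m rho) = rho *m (B *m rho).
  by move: rKr; rewrite mulmxBr mulmxBl -!mulmxA => /eqP; rewrite subr_eq0 => /eqP.
(* [rKr = 0] leaves the blocks of [K] from the support of [rho] to its kernel *)
have KB X : psd X -> K *m rho *m X *m rho = 0 -> X *m rho *m K = 0.
  move=> pX KX; rewrite -mulmxA; apply: (psd_ker pX).
  by rewrite hadjM hr hK !mulmxA KX mul0mx.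
have BK : B *m rho *m K = 0.
  apply: (KB _ pB); rewrite !mulmxBl -E.
  by rewrite -!mulmxA rAB subrr.
have AK : A *m rho *m K = 0.
  apply: (KB _ pA); rewrite !mulmxBl E.
  by rewrite -!mulmxA rAB subrr.
have rK : rho *m K = 0.
  by apply: (psd_ker pr); rewrite hK !mulmxBl AK BK subrr.
have : K *m rho = 0 by rewrite -hK -{1}hr -hadjM rK hadj0.
by rewrite mulmxBl => /eqP; rewrite subr_eq0 => /eqP.
Qed.

Lemma sqrt_lr_refl rho : psd rho -> sqrt_lr rho rho 1%:M.
Proof.
move=> pr; apply/(sqrt_lrP _ _ pr); rewrite mul1mx mulmx1 subrr mul0mx.
by split; [exact: psd1|exact: psd0|].
Qed.

End LikelihoodRatio.

(** * Functional calculus of Hermitian matrices *)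

Section Similarity.
Variables (K : fieldType) (D : nat).
Implicit Types (S T U V P Q W : 'M[K]_D).

Lemma mul_similar S T P Q : S *m T = 1%:M ->
  (T *m P *m S) *m (T *m Q *m S) = T *m (P *m Q) *m S.
Proof. by move=> ST; rewrite -!mulmxA (mulmxA S) ST mul1mx. Qed.

Lemma similar_intertwine S T U V P Q : S *m T = 1%:M -> U *m V = 1%:M ->
  T *m P *m S = V *m Q *m U -> P *m (S *m V) = (S *m V) *m Q.
Proof.
move=> ST UV E.
have : S *m (T *m P *m S) *m V = S *m (V *m Q *m U) *m V by rewrite E.
by rewrite !mulmxA ST mul1mx => ->; rewrite -!mulmxA UV mulmx1.
Qed.

Lemma intertwine_similar S T U V P Q : T *m S = 1%:M -> V *m U = 1%:M ->
  P *m (S *m V) = (S *m V) *m Q -> T *m P *m S = V *m Q *m U.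
Proof.
move=> TS VU E.
have : T *m (P *m (S *m V)) *m U = T *m (S *m V *m Q) *m U by rewrite E.
by rewrite !mulmxA TS mul1mx -[_ *m V *m U]mulmxA VU mulmx1.
Qed.

End Similarity.

Section FunctionalCalculus.
Variables (R : realType) (D : nat).
Local Notation C := R[i].
Implicit Types (A : 'M[C]_D) (f g : R -> C) (l : 'rV[R]_D).

(** The intertwiner [W] between two diagonalizations of a matrix satisfies
    [(m_a - l_b) W_ab = 0], so it also intertwines the images under [f]. *)
Lemma diag_similar f (S V U : 'M[C]_D) (m l : 'rV[R]_D) :
  S \in unitmx -> V *m U = 1%:M ->
  invmx S *m diag_mx (map_mx (fun x => x%:C) m) *m S =
    V *m diag_mx (map_mx (fun x => x%:C) l) *m U ->
  invmx S *m diag_mx (map_mx f m) *m S = V *m diag_mx (map_mx f l) *m U.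
Proof.
move=> uS VU E; have UV := mulmx1C VU.
have W := similar_intertwine (mulmxV uS) UV E.
apply: (intertwine_similar (mulVmx uS) VU).
move: W; move: (S *m V) => w; rewrite !mul_diag_mx !mul_mx_diag => /matrixP W.
apply/matrixP => a b; move: (W a b); rewrite !mxE => Wab.
have [->|w0] := eqVneq (w a b) 0; first by rewrite mulr0 mul0r.
have /complexI -> : (m 0 a)%:C = (l 0 b)%:C by apply: (mulIf w0); rewrite Wab mulrC.
by rewrite mulrC.
Qed.

(** Functional calculus does not depend on the diagonalization; in particular it
    may be computed in a product basis. *)
Lemma hfunE f A (V U : 'M[C]_D) l : V *m U = 1%:M ->
  A = V *m diag_mx (map_mx (fun x => x%:C) l) *m U -> A \is hermsymmx ->
  hfun f A = V *m diag_mx (map_mx f l) *m U.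
Proof.
move=> VU AE hA.
have E := herm_spectral hA; rewrite [X in X = _]AE in E.
have sE g : map_mx (fun z => g (complex.Re z)) (spectral_diag A) =
    map_mx g (map_mx (fun z => complex.Re z) (spectral_diag A)).
  by rewrite -map_mx_comp.
rewrite /hfun sE; apply: diag_similar; [exact: spectral_unit|exact: VU|].
by rewrite -(sE (fun x => x%:C)) -E.
Qed.

Lemma eq_hfun f g A : f =1 g -> hfun f A = hfun g A.
Proof. by move=> /funext ->. Qed.

Lemma hfun_cst1 A : hfun (fun=> 1) A = 1%:M.
Proof.
rewrite /hfun (_ : diag_mx _ = 1%:M) ?mulmx1 ?mulVmx ?spectral_unit//.
by apply/matrixP => a b; rewrite !mxE.
Qed.

Lemma hfun_id A : A \is hermsymmx -> hfun (fun x => x%:C) A = A.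
Proof. by move=> hA; rewrite [RHS](herm_spectral hA). Qed.

Lemma hfunM f g A : hfun f A *m hfun g A = hfun (fun x => f x * g x) A.
Proof.
rewrite /hfun (mul_similar _ _ (mulmxV (spectral_unit A))) mulmx_diag.
suff -> : \row_j (map_mx (fun z => f (complex.Re z)) (spectral_diag A) 0 j *
    map_mx (fun z => g (complex.Re z)) (spectral_diag A) 0 j) =
  map_mx (fun z => f (complex.Re z) * g (complex.Re z)) (spectral_diag A) by [].
by apply/rowP => a; rewrite !mxE.
Qed.

Lemma hfunZ c f A : hfun (fun x => c * f x) A = c *: hfun f A.
Proof.
rewrite /hfun scalemxAl scalemxAr -linearZ.
suff -> : map_mx (fun z => c * f (complex.Re z)) (spectral_diag A) =
  c *: map_mx (fun z => f (complex.Re z)) (spectral_diag A) by [].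
by apply/rowP => a; rewrite !mxE.
Qed.

Lemma hfunD f g A : hfun (fun x => f x + g x) A = hfun f A + hfun g A.
Proof.
rewrite /hfun -mulmxDl -mulmxDr -linearD.
suff -> : map_mx (fun z => f (complex.Re z) + g (complex.Re z)) (spectral_diag A) =
  map_mx (fun z => f (complex.Re z)) (spectral_diag A) +
  map_mx (fun z => g (complex.Re z)) (spectral_diag A) by [].
by apply/rowP => a; rewrite !mxE.
Qed.

Lemma hfunB f g A : hfun (fun x => f x - g x) A = hfun f A - hfun g A.
Proof.
rewrite -scaleN1r -hfunZ -hfunD.
by apply: eq_hfun => x; rewrite mulN1r.
Qed.

Lemma hfun_psd (r : R -> R) A : (forall x, 0 <= r x) ->
  psd (hfun (fun x => (r x)%:C) A).
Proof.
move=> r0; rewrite /hfun invmx_unitary ?spectral_unitarymx//.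
set S := spectralmx A; set mu := spectral_diag A.
suff -> : diag_mx (map_mx (fun z : C => (r (complex.Re z))%:C) mu) =
  (diag_mx (map_mx (fun z : C => (Num.sqrt (r (complex.Re z)))%:C) mu))^t* *m
  diag_mx (map_mx (fun z : C => (Num.sqrt (r (complex.Re z)))%:C) mu).
  rewrite -!mulmxA mulmxA -hadjM; exact: psd_gram.
rewrite tr_diag_mx map_diag_mx mulmx_diag; congr diag_mx.
apply/rowP => a; rewrite !mxE.
transitivity ((Num.sqrt (r (complex.Re (mu 0 a))))%:C *
  (Num.sqrt (r (complex.Re (mu 0 a))))%:C).
  by rewrite -rmorphM -expr2 sqr_sqrtr.
congr (_ * _); apply/esym; exact: conjc_real.
Qed.

(** A real function is a difference of two nonnegative ones. *)
Lemma hfun_herm (r : R -> R) A : hfun (fun x => (r x)%:C) A \is hermsymmx.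
Proof.
have -> : hfun (fun x => (r x)%:C) A =
  hfun (fun x => (Num.max (r x) 0)%:C) A - hfun (fun x => (Num.max (- r x) 0)%:C) A.
  rewrite -hfunB; apply: eq_hfun => x; rewrite -rmorphB/=; congr _%:C.
  case: (leP (r x) 0) => rx; case: (leP (- r x) 0) => nrx; lra.
by apply: hermB; apply: (proj1 (hfun_psd _ _)) => x; rewrite le_max lexx orbT.
Qed.

Lemma hfun_comp f (r : R -> R) A : A \is hermsymmx ->
  hfun f (hfun (fun x => (r x)%:C) A) = hfun (fun x => f (r x)) A.
Proof.
move=> hA; rewrite (@hfunE f _ (invmx (spectralmx A)) (spectralmx A)
  (map_mx (fun z => r (complex.Re z)) (spectral_diag A))).
- by rewrite /hfun -map_mx_comp.
- by rewrite mulVmx ?spectral_unit.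
- by rewrite /hfun -map_mx_comp.
- exact: hfun_herm.
Qed.

Lemma hfun_affine f (c d : R) A : A \is hermsymmx ->
  hfun f (c%:C *: A + d%:C *: 1%:M) = hfun (fun x => f (c * x + d)) A.
Proof.
move=> hA; rewrite -(hfun_comp f (fun x => c * x + d) hA); congr hfun.
rewrite -{1}(hfun_id hA) -(hfun_cst1 A) -!hfunZ -hfunD.
by apply: eq_hfun => x; rewrite rmorphD rmorphM mulr1.
Qed.

Lemma hfun_scale f (c : R) A : A \is hermsymmx ->
  hfun f (c%:C *: A) = hfun (fun x => f (c * x)) A.
Proof.
move=> hA; rewrite -(hfun_comp f (fun x => c * x) hA); congr hfun.
by rewrite -{1}(hfun_id hA) -hfunZ; apply: eq_hfun => x; rewrite rmorphM.
Qed.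

Lemma hfun0 f : hfun f (0 : 'M[C]_D) = f 0 *: 1%:M.
Proof.
rewrite (@hfunE f _ 1%:M 1%:M 0) ?mul1mx ?mulmx1//; last exact: herm0.
  by apply/matrixP => a b; rewrite !mxE mulr_natr.
by apply/matrixP => a b; rewrite !mxE mul0rn.
Qed.

End FunctionalCalculus.

Section FunctionalCalculusTaylor.
Variables (R : realType) (D : nat) (T : Type) (F : set_system T).
Context {FF : Filter F}.
Variable e : T -> R.
Hypothesis e0 : e t @[t --> F] --> (0 : R).
Hypothesis en0 : \forall t \near F, e t != 0.

(** The expansion [U = 1 + e U1 + e^2 U2 + o(e^2)]. *)
Definition taylor2 (U : T -> 'M[R[i]]_D) (U1 U2 : 'M[R[i]]_D) : Prop :=
  mto F (fun t => ((e t)^-1 ^+ 2)%:C *: (U t - 1%:M - (e t)%:C *: U1)) U2.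

Lemma taylor2_slope U U1 U2 : taylor2 U U1 U2 ->
  mto F (fun t => ((e t)^-1)%:C *: (U t - 1%:M)) U1.
Proof.
move=> tU; have H : mto F (fun t => (e t)%:C *: (((e t)^-1 ^+ 2)%:C *:
    (U t - 1%:M - (e t)%:C *: U1)) + U1) U1.
  rewrite -[X in mto _ _ X]add0r -(scale0r U2); apply: mtoD; last exact: mto_cst.
  apply: mtoZ => //; exact: cto_real.
apply: mto_near H; near=> t; have et0 : e t != 0 by near: t.
have ee : ((e t)^-1)%:C * (e t)%:C = 1 by rewrite -rmorphM mulVf.
rewrite scalerA -rmorphM (_ : e t * (e t)^-1 ^+ 2 = (e t)^-1); last by field.
by rewrite [in LHS]scalerBr scalerA ee scale1r subrK.
Unshelve. all: by end_near. Qed.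

Lemma taylor2_lim U U1 U2 : taylor2 U U1 U2 -> mto F U 1%:M.
Proof.
move=> /taylor2_slope tU.
have H : mto F (fun t => (e t)%:C *: (((e t)^-1)%:C *: (U t - 1%:M)) + 1%:M) 1%:M.
  rewrite -[X in mto _ _ X]add0r -(scale0r U1); apply: mtoD; last exact: mto_cst.
  apply: mtoZ => //; exact: cto_real.
apply: mto_near H; near=> t; have et0 : e t != 0 by near: t.
by rewrite scalerA -rmorphM divff// scale1r subrK.
Unshelve. all: by end_near. Qed.

Lemma taylor2_1 : taylor2 (fun=> 1%:M) 0 0.
Proof.
rewrite /taylor2; under eq_fun do rewrite subrr scaler0 subr0 scaler0.
exact: mto_cst.
Qed.

(** [UV - 1 - e (U1 + V1)] splits as
    [(U - 1 - e U1) V + e U1 (V - 1) + (V - 1 - e V1)]. *)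
Lemma taylor2M U U1 U2 V V1 V2 : taylor2 U U1 U2 -> taylor2 V V1 V2 ->
  taylor2 (fun t => U t *m V t) (U1 + V1) (U2 + U1 *m V1 + V2).
Proof.
move=> tU tV.
pose proof (mtoD (mtoD (mtoM tU (taylor2_lim tV))
  (mtoM (mto_cst U1) (taylor2_slope tV))) tV) as H.
rewrite mulmx1 in H; apply: mto_near H; near=> t.
have et0 : e t != 0 by near: t.
have -> : U t *m V t - 1%:M - (e t)%:C *: (U1 + V1) =
  (U t - 1%:M - (e t)%:C *: U1) *m V t + (e t)%:C *: (U1 *m (V t - 1%:M)) +
  (V t - 1%:M - (e t)%:C *: V1).
  rewrite !mulmxBl mul1mx mulmxBr mulmx1 -scalemxAl scalerBr scalerDr.
  by apply/matrixP => a b; rewrite !mxE; ring.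
rewrite [in RHS]scalerDr [in RHS]scalerDr -scalemxAl; congr (_ + _ + _).
rewrite -scalemxAr scalerA -rmorphM; congr (_%:C *: _); field.
Unshelve. all: by end_near. Qed.

Lemma taylor2_hfun f a b (M : 'M[R[i]]_D) : csecond_order f a b -> f 0 = 1 ->
  M \is hermsymmx ->
  taylor2 (fun t => hfun f ((e t)%:C *: M)) (a *: M) (b *: (M *m M)).
Proof.
move=> sf f01 hM.
have -> : a *: M = hfun (fun x => a * x%:C) M by rewrite hfunZ hfun_id.
have -> : b *: (M *m M) = hfun (fun x => b * (x ^+ 2)%:C) M.
  have MM : hfun (fun x => x%:C) M *m hfun (fun x => x%:C) M = M *m M by rewrite (hfun_id hM).
  rewrite -MM hfunM -hfunZ.
  by apply: eq_hfun => x; rewrite -rmorphM.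
rewrite /taylor2.
have -> : (fun t => ((e t)^-1 ^+ 2)%:C *: (hfun f ((e t)%:C *: M) - 1%:M -
    (e t)%:C *: hfun (fun x => a * x%:C) M)) =
  (fun t => hfun (fun x => ((e t)^-1 ^+ 2)%:C *
    (f (e t * x) - f 0 - a * (e t * x)%:C)) M).
  apply/funext => t; rewrite hfun_scale// -(hfun_cst1 M) -hfunZ -!hfunB -hfunZ.
  by apply: eq_hfun => x; rewrite f01 mulrCA -rmorphM.
rewrite /hfun; apply: mtoM; last exact: mto_cst.
apply: mtoM; first exact: mto_cst.
move=> i j; rewrite !mxE; have [->|ij] := eqVneq i j; last first.
  by under eq_fun do rewrite !mxE (negbTE ij) mulr0n; rewrite mulr0n; exact: cto_cst.
under eq_fun do rewrite !mxE eqxx mulr1n.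
by rewrite mulr1n; exact: csecond_order_cvg.
Qed.

End FunctionalCalculusTaylor.

(** * Tensor powers *)

Section Tensor.
Variable K : comNzRingType.

Lemma tens11 m n : (1%:M : 'M[K]_m) *t (1%:M : 'M[K]_n) = 1%:M.
Proof.
apply/matrixP => i j; case: (mxtens_indexP i) => a b; case: (mxtens_indexP j) => c d.
rewrite tensmxE !mxE (can_eq (@mxtens_indexK m n)) xpair_eqE.
by case: (a == c); rewrite ?mul0r ?mul1r.
Qed.

Lemma tensDl m n p q (A B : 'M[K]_(m, n)) (M : 'M[K]_(p, q)) :
  (A + B) *t M = A *t M + B *t M.
Proof. by apply/matrixP => i j; rewrite !mxE mulrDl. Qed.

Lemma tensDr m n p q (A B : 'M[K]_(m, n)) (M : 'M[K]_(p, q)) :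
  M *t (A + B) = M *t A + M *t B.
Proof. by apply/matrixP => i j; rewrite !mxE mulrDr. Qed.

Lemma tensZl m n p q c (A : 'M[K]_(m, n)) (M : 'M[K]_(p, q)) :
  (c *: A) *t M = c *: (A *t M).
Proof. by apply/matrixP => i j; rewrite !mxE mulrA. Qed.

Lemma tensZr m n p q c (A : 'M[K]_(m, n)) (M : 'M[K]_(p, q)) :
  M *t (c *: A) = c *: (M *t A).
Proof. by apply/matrixP => i j; rewrite !mxE mulrCA. Qed.

Lemma tens_sumr m n p q (I : Type) (s : seq I) (A : I -> 'M[K]_(m, n)) (M : 'M[K]_(p, q)) :
  M *t (\sum_(i <- s) A i) = \sum_(i <- s) M *t A i.
Proof.
elim: s => [|i s IH]; first by rewrite !big_nil tensmx0.
by rewrite !big_cons tensDr IH.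
Qed.

Lemma tens_suml m n p q (I : Type) (s : seq I) (A : I -> 'M[K]_(m, n)) (M : 'M[K]_(p, q)) :
  (\sum_(i <- s) A i) *t M = \sum_(i <- s) A i *t M.
Proof.
elim: s => [|i s IH]; first by rewrite !big_nil tens0mx.
by rewrite !big_cons tensDl IH.
Qed.

Lemma mxtrace_tens m n (A : 'M[K]_m) (B : 'M[K]_n) : \tr (A *t B) = \tr A * \tr B.
Proof.
rewrite /mxtrace mulr_sum; apply: eq_bigr => k _; by rewrite mxE.
Qed.

End Tensor.

Section TensorPowers.
Variables (R : realType) (D : nat).
Local Notation C := R[i].
Implicit Types (A B rho sigma : 'M[C]_D).

Lemma adj_tens m n p q (A : 'M[C]_(m, n)) (B : 'M[C]_(p, q)) :
  (A *t B)^t* = A^t* *t B^t*.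
Proof. by apply/matrixP => i j; rewrite !mxE rmorphM. Qed.

Lemma psd_tens m n (A : 'M[C]_m) (B : 'M[C]_n) : psd A -> psd B -> psd (A *t B).
Proof.
move=> /psd_factor[G ->] /psd_factor[H ->].
by rewrite -tensmx_mul -adj_tens; exact: psd_gram.
Qed.

Lemma tpowS n A : tpow n.+1 A = A *t tpow n A.
Proof. by []. Qed.

Lemma tpow1 n : tpow n (1%:M : 'M[C]_D) = 1%:M.
Proof. by elim: n => // n IH; rewrite tpowS IH tens11. Qed.

Lemma tpowM n A B : tpow n (A *m B) = tpow n A *m tpow n B.
Proof.
elim: n => [|n IH]; first by rewrite /tpow/= mulmx1.
by rewrite !tpowS IH tensmx_mul.
Qed.

Lemma tr_tpow n A : \tr (tpow n A) = \tr A ^+ n.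
Proof.
elim: n => [|n IH]; first by rewrite /tpow/= expr0 mxtrace1.
by rewrite tpowS mxtrace_tens IH exprS.
Qed.

Lemma tpow_prod n (r : nat) (A : 'I_r -> 'M[C]_D) :
  tpow n (\big[mulmx/1%:M]_(t < r) A t) = \big[mulmx/1%:M]_(t < r) tpow n (A t).
Proof. by apply: (big_morph (tpow n)); [exact: tpowM|exact: tpow1]. Qed.

Lemma psd_tpow n A : psd A -> psd (tpow n A).
Proof.
move=> pA; elim: n => [|n IH]; first exact: psd1.
by rewrite tpowS; exact: psd_tens.
Qed.

(** One factor at a time: [sigma (x) S - A (x) T] is
    [(sigma - A) (x) S + A (x) (S - T)]. *)
Lemma psd_tpowB n sigma A : psd A -> psd (sigma - A) ->
  psd (tpow n sigma - tpow n A).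
Proof.
move=> pA pS; have ps : psd sigma by rewrite -(subrK A sigma); exact: psdD.
elim: n => [|n IH]; first by rewrite subrr; exact: psd0.
have -> : tpow n.+1 sigma - tpow n.+1 A =
    (sigma - A) *t tpow n sigma + A *t (tpow n sigma - tpow n A).
  by rewrite !tpowS; apply/matrixP => i j; rewrite !mxE; ring.
apply: psdD; first exact: psd_tens pS (psd_tpow n ps).
exact: psd_tens pA IH.
Qed.

(** The remainder [sigma^n - (A rho A)^n] is positive by [psd_tpowB], and it kills
    [rho^n] because [sigma rho = A rho A rho]. *)
Lemma sqrt_lr_tpow n sigma rho A : psd rho -> sqrt_lr sigma rho A ->
  sqrt_lr (tpow n sigma) (tpow n rho) (tpow n A).
Proof.
move=> pr /(sqrt_lrP _ _ pr)[pA pS s0].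
apply/(sqrt_lrP _ _ (psd_tpow n pr)); rewrite -!tpowM; split.
- exact: psd_tpow.
- suff pAr : psd (A *m rho *m A) by exact: psd_tpowB pAr pS.
  by move: (psd_conj A pr); rewrite (psd_herm pA).
- rewrite mulmxBl -!tpowM; apply/eqP; rewrite subr_eq0; apply/eqP.
  by congr tpow; apply/eqP; rewrite -subr_eq0 -mulmxBl s0.
Qed.

Lemma tsiteS0 n A : tsite (ord0 : 'I_n.+1) A = A *t 1%:M.
Proof.
by rewrite /tsite/= -(tpow1 n).
Qed.

Lemma tsiteSS n (k : 'I_n) A : tsite (lift ord0 k) A = 1%:M *t tsite k A.
Proof.
by rewrite /tsite/=; congr (_ *t tprod _).
Qed.

Lemma tsite_sumS n A : \sum_(k < n.+1) tsite k A =
  A *t 1%:M + 1%:M *t \sum_(k < n) tsite k A.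
Proof.
by rewrite big_ord_recl tsiteS0 tens_sumr.
Qed.

Lemma herm_tens m n (A : 'M[C]_m) (B : 'M[C]_n) :
  A \is hermsymmx -> B \is hermsymmx -> A *t B \is hermsymmx.
Proof. by move=> /hermE hA /hermE hB; apply/hermE; rewrite adj_tens hA hB. Qed.

Lemma herm1 n : (1%:M : 'M[C]_n) \is hermsymmx.
Proof. by apply/hermE; rewrite hadj1. Qed.

Lemma herm_tsite_sum n A : A \is hermsymmx -> \sum_(k < n) tsite k A \is hermsymmx.
Proof.
move=> hA; elim: n => [|n IH]; first by rewrite big_ord0; exact: herm0.
rewrite tsite_sumS; apply: hermD; first exact: herm_tens hA (herm1 _).
exact: herm_tens (herm1 _) IH.
Qed.

Lemma tsite_lin n (k : 'I_n) (I : finType) (c : I -> C) (B : I -> 'M[C]_D) :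
  tsite k (\sum_i c i *: B i) = \sum_i c i *: tsite k (B i).
Proof.
elim: n k => [[]//|n IH] k; have [->|[j ->]] : k = ord0 \/ exists j, k = lift ord0 j.
- by case: (unliftP ord0 k) => [j ->|->]; [right; exists j|left].
- rewrite tsiteS0 tens_suml; apply: eq_bigr => i _.
  by rewrite tsiteS0 tensZl.
- rewrite tsiteSS IH tens_sumr; apply: eq_bigr => i _.
  by rewrite tsiteSS tensZr.
Qed.

Lemma normalized_sum_lin n (I : finType) (c : I -> C) (B : I -> 'M[C]_D) :
  \sum_i c i *: normalized_sum (B i) n = normalized_sum (\sum_i c i *: B i) n.
Proof.
rewrite /normalized_sum; under eq_bigr do rewrite scalerA mulrC -scalerA.
rewrite -scaler_sumr; congr (_ *: _).
under [RHS]eq_bigr do rewrite tsite_lin.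
by rewrite exchange_big; apply: eq_bigr => i _; rewrite scaler_sumr.
Qed.

Lemma herm_normalized_sum n A : A \is hermsymmx -> normalized_sum A n \is hermsymmx.
Proof. by move=> hA; apply: hermZ; exact: herm_tsite_sum. Qed.

(** If [f (x + y) = f x * f y], then [f (A (x) 1 + 1 (x) B) = f A (x) f B]:
    the two summands are diagonal in a common product basis. *)
Lemma hfun_tens m n f (A : 'M[C]_m) (B : 'M[C]_n) :
  (forall x y : R, f (x + y) = f x * f y) ->
  A \is hermsymmx -> B \is hermsymmx ->
  hfun f (A *t 1%:M + 1%:M *t B) = hfun f A *t hfun f B.
Proof.
move=> fD hA hB.
pose a := map_mx (fun z : C => complex.Re z) (spectral_diag A).
pose b := map_mx (fun z : C => complex.Re z) (spectral_diag B).
pose S := spectralmx A; pose T := spectralmx B.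
have SS : invmx S *m S = 1%:M by rewrite mulVmx// spectral_unit.
have TT : invmx T *m T = 1%:M by rewrite mulVmx// spectral_unit.
have EA g : hfun g A = invmx S *m diag_mx (map_mx g a) *m S by rewrite /a -map_mx_comp.
have EB g : hfun g B = invmx T *m diag_mx (map_mx g b) *m T by rewrite /b -map_mx_comp.
pose l : 'rV[R]_(m * n) := \row_k (a 0 (mxtens_unindex k).1 + b 0 (mxtens_unindex k).2).
rewrite (@hfunE _ _ f _ (invmx S *t invmx T) (S *t T) l).
- have -> : diag_mx (map_mx f l) = diag_mx (map_mx f a) *t diag_mx (map_mx f b).
    apply/matrixP => i j; case: (mxtens_indexP i) => x y; case: (mxtens_indexP j) => z w.
    rewrite tensmxE !mxE (can_eq (@mxtens_indexK m n)) xpair_eqE mxtens_indexK/= fD.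
    by case: (x == z); case: (y == w); rewrite ?mulr0n ?mulr1n ?mulr0 ?mul0r.
  by rewrite !tensmx_mul -EA -EB.
- by rewrite tensmx_mul SS TT tens11.
- have -> : diag_mx (map_mx (fun x => x%:C) l) =
      diag_mx (map_mx (fun x => x%:C) a) *t 1%:M + 1%:M *t diag_mx (map_mx (fun x => x%:C) b).
    apply/matrixP => i j; case: (mxtens_indexP i) => x y; case: (mxtens_indexP j) => z w.
    rewrite mxE [in RHS]mxE !tensmxE !mxE (can_eq (@mxtens_indexK m n)) xpair_eqE mxtens_indexK/=.
    case: (x == z); case: (y == w);
      by rewrite ?mulr0n ?mulr1n ?mulr0 ?mul0r ?mul1r ?mulr1 ?addr0 ?rmorphD.
  by rewrite mulmxDr mulmxDl !tensmx_mul -EA -EB !mulmx1 SS TT !hfun_id.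
- apply: hermD; first exact: herm_tens hA (herm1 _).
  exact: herm_tens (herm1 _) hB.
Qed.

Lemma hfun_tsite_sum n f (c : R) A : (forall x y : R, f (x + y) = f x * f y) ->
  f 0 = 1 -> A \is hermsymmx ->
  hfun f (c%:C *: \sum_(k < n) tsite k A) = tpow n (hfun f (c%:C *: A)).
Proof.
move=> fD f0 hA; elim: n => [|n IH].
  by rewrite big_ord0 scaler0 hfun0 f0 scale1r.
rewrite tsite_sumS scalerDr -tensZl -tensZr hfun_tens//.
- by rewrite IH.
- exact: hermZ.
- by apply: hermZ; exact: herm_tsite_sum.
Qed.

(** A multiplicative function of a normalized sum is a tensor power, so that
    traces against product states become [n]-th powers. *)
Lemma hfun_normalized_sum n f A : (forall x y : R, f (x + y) = f x * f y) ->
  f 0 = 1 -> A \is hermsymmx ->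
  hfun f (normalized_sum A n) = tpow n (hfun f ((rt R n)%:C *: A)).
Proof. by move=> fD f0 hA; exact: hfun_tsite_sum. Qed.

End TensorPowers.

(** * Expansions around a state *)

Section LimitFacts.
Variables (R : realType) (T : Type) (F : set_system T).
Context {FF : ProperFilter F}.

Lemma cto_unique (u : T -> R[i]) l m : cto F u l -> cto F u m -> l = m.
Proof.
move=> [ur ui] [vr vi]; apply: complex_ext.
  exact: cvg_unique ur vr.
exact: cvg_unique ui vi.
Qed.

Lemma mto_unique p q (U : T -> 'M[R[i]]_(p, q)) A B : mto F U A -> mto F U B -> A = B.
Proof. by move=> UA UB; apply/matrixP => a b; exact: cto_unique (UA a b) (UB a b). Qed.

Lemma mto_adj p q (U : T -> 'M[R[i]]_(p, q)) A : mto F U A ->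
  mto F (fun t => (U t)^t* ) (A^t* ).
Proof.
move=> UA a b; rewrite hadjE; under eq_fun do rewrite hadjE.
exact: cto_conj.
Qed.

End LimitFacts.

Section AntiCommutator.
Variables (R : realType) (D : nat).
Implicit Types (A B K rho : 'M[R[i]]_D).

(** The trace of [K (K rho + rho K)] is twice that of [K^2 rho], a product of
    two positive operators. *)
Lemma anticomm_eq0 K rho : psd rho -> K \is hermsymmx ->
  K *m rho + rho *m K = 0 -> K *m rho = 0.
Proof.
move=> pr /hermE hK E.
have pK : psd (K *m K) by rewrite -{1}hK; exact: psd_gram.
have t0 : \tr (K *m K *m rho) = 0.
  have : \tr (K *m (K *m rho + rho *m K)) = 0 by rewrite E mulmx0 mxtrace0.
  rewrite mulmxDr mxtraceD !mulmxA [X in _ + X]mxtrace_mulC !mulmxA.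
  rewrite -[X in X + X]mul1r -mulrDl => /eqP; rewrite mulf_eq0 (_ : 1 + 1 = 2%:R)//.
  by rewrite pnatr_eq0/= => /eqP.
have Z := psd_trM_eq0 pK pr t0.
apply: gram_eq0; rewrite hadjM (psd_herm pr) hK.
by rewrite -!mulmxA (mulmxA K K) Z mulmx0.
Qed.

End AntiCommutator.

(** [Rt] and [rhot] stand for [Rh] and [rho] along a direction, [e] for the size
    of the displacement. *)
Section LocalExpansion.
Variables (R : realType) (D : nat) (T : Type) (F : set_system T).
Context {FF : Filter F}.
Variable e : T -> R.
Hypothesis e0 : e t @[t --> F] --> (0 : R).
Hypothesis en0 : \forall t \near F, e t != 0.
Variables (rho0 R0 A : 'M[R[i]]_D) (Rt rhot : T -> 'M[R[i]]_D).
Hypothesis rho0_psd : psd rho0.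
Hypothesis rho0_tr : \tr rho0 = 1.
Hypothesis R0_rho0 : R0 *m rho0 = rho0.
Hypothesis rho0_R0 : rho0 *m R0 = rho0.
Hypothesis Rt_lr : \forall t \near F, sqrt_lr (rhot t) rho0 (Rt t).
Hypothesis rhot_tr : \forall t \near F, \tr (rhot t) = 1.
Hypothesis Rt_slope : mto F (fun t => ((e t)^-1)%:C *: (Rt t - R0)) A.
Hypothesis Rt_norm :
  cto F (fun t => ((e t)^-1 ^+ 2)%:C * (\tr (rho0 *m (Rt t *m Rt t)) - 1)) 0.

Lemma ec0 : cto F (fun t => (e t)%:C) 0.
Proof. exact: cto_real. Qed.

Lemma mulVec t : e t != 0 -> ((e t)^-1)%:C * (e t)%:C = 1.
Proof. by move=> et; rewrite -rmorphM mulVf. Qed.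

Lemma Rt_lim : mto F Rt R0.
Proof.
pose proof (mtoD (mtoZ ec0 Rt_slope) (mto_cst R0)) as H.
rewrite scale0r add0r in H; apply: mto_near H; near=> t.
have et0 : e t != 0 by near: t.
by rewrite scalerA mulrC mulVec// scale1r subrK.
Unshelve. all: by end_near. Qed.

(** As [R0] fixes [rho0], expanding the square gives
    [\tr (rho0 Rt^2) = 2 \tr (rho0 Rt) - 1 + \tr (rho0 (Rt - R0)^2)], where the last
    term is known to second order from the first derivative alone. *)
Lemma tr_Rt_second :
  cto F (fun t => ((e t)^-1 ^+ 2)%:C * (\tr (rho0 *m Rt t) - 1))
    (- 2^-1 * \tr (rho0 *m (A *m A))).
Proof.
have H2 : cto F (fun t => \tr (rho0 *m ((((e t)^-1)%:C *: (Rt t - R0)) *m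
    (((e t)^-1)%:C *: (Rt t - R0))))) (\tr (rho0 *m (A *m A))).
  by apply: mto_tr; apply: mtoM; [exact: mto_cst|exact: mtoM].
pose proof (ctoB (ctoM (cto_cst 2^-1) Rt_norm) (ctoM (cto_cst 2^-1) H2)) as H.
rewrite mulr0 sub0r -mulNr in H; apply: cto_near H; near=> t.
have cc x : ((e t)^-1)%:C * (((e t)^-1)%:C * x) = ((e t)^-1 ^+ 2)%:C * x.
  by rewrite mulrA -rmorphM -expr2.
rewrite -scalemxAl -!scalemxAr !mxtraceZ cc.
rewrite mulrCA [2^-1 * (_ * _)]mulrCA -mulrBr; congr (_ * _).
rewrite mulmx_subsub mxtraceD !mxtraceB.
have -> : \tr (rho0 *m (Rt t *m R0)) = \tr (rho0 *m Rt t).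
  by rewrite mulmxA mxtrace_mulC mulmxA R0_rho0.
rewrite (mulmxA rho0 R0 (Rt t)) (mulmxA rho0 R0 R0) !rho0_R0 rho0_tr.
by field.
Unshelve. all: by end_near. Qed.

(** Otherwise [\tr (rho0 Rt) - 1] would be of order [e], not [e^2]. *)
Lemma tr_rho0_A (PF : ProperFilter F) : \tr (rho0 *m A) = 0.
Proof.
have H1 : cto F (fun t => \tr (rho0 *m (((e t)^-1)%:C *: (Rt t - R0)))) (\tr (rho0 *m A)).
  by apply: mto_tr; apply: mtoM => //; exact: mto_cst.
pose proof (ctoM ec0 tr_Rt_second) as H2; rewrite mul0r in H2.
apply: cto_unique H1 _; apply: cto_near H2; near=> t.
have et0 : e t != 0 by near: t.
rewrite -scalemxAr mxtraceZ mulmxBr mxtraceB rho0_R0 rho0_tr mulrA -rmorphM.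
by congr (_%:C * _); field.
Unshelve. all: by end_near. Qed.

(** The singular part of [rhot] has trace [o(e^2)], hence entries [o(e)]. *)
Lemma rhot_slope :
  mto F (fun t => ((e t)^-1)%:C *: (rhot t - rho0)) (A *m rho0 + rho0 *m A).
Proof.
have H1 : mto F (fun t => (((e t)^-1)%:C *: (Rt t - R0)) *m rho0 *m Rt t +
    rho0 *m (((e t)^-1)%:C *: (Rt t - R0))) (A *m rho0 + rho0 *m A).
  have E : A *m rho0 + rho0 *m A = A *m rho0 *m R0 + rho0 *m A by rewrite -mulmxA rho0_R0.
  rewrite {1}E; apply: mtoD; last by apply: mtoM => //; exact: mto_cst.
  by apply: mtoM; [apply: mtoM => //; exact: mto_cst|exact: Rt_lim].
have H2 : mto F (fun t => ((e t)^-1)%:C *: (rhot t - Rt t *m rho0 *m Rt t))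
    (0 : 'M[R[i]]_D).
  move=> a b; rewrite mxE; apply: cto_norm0.
  pose proof (norm_cto0 Rt_norm) as H.
  have H' : normc (((e t)^-1 ^+ 2)%:C * (\tr (rho0 *m (Rt t *m Rt t)) - 1)) * `|e t|
      @[t --> F] --> (0 : R).
    by rewrite -(mulr0 0); apply: cvgM => //; rewrite -(normr0 R); exact: cvg_norm.
  apply: cvg0_dominated H'; near=> t.
  have et0 : e t != 0 by near: t.
  have lrt : sqrt_lr (rhot t) rho0 (Rt t) by near: t.
  have trt : \tr (rhot t) = 1 by near: t.
  have [pR pS _] := proj1 (sqrt_lrP _ _ rho0_psd) lrt.
  rewrite ger0_norm ?normc_ge0// mxE normcM.
  have nr (x : R) : normc x%:C = `|x| by rewrite /= expr0n/= addr0 sqrtr_sqr.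
  rewrite normcM !nr normrX normrV ?unitfE// mulrAC.
  have -> : `|e t|^-1 ^+ 2 * `|e t| = `|e t|^-1 by field; rewrite normr_eq0.
  rewrite ler_wpM2l ?invr_ge0//.
  apply: (le_trans (psd_entry a b pS)).
  rewrite mxtraceB trt.
  have -> : 1 - \tr (Rt t *m rho0 *m Rt t) = - (\tr (rho0 *m (Rt t *m Rt t)) - 1).
    have -> : \tr (Rt t *m rho0 *m Rt t) = \tr (rho0 *m (Rt t *m Rt t)).
      by rewrite -mulmxA mxtrace_mulC mulmxA.
    by rewrite opprB.
  by rewrite -normcN; exact: Re_le_normc.
pose proof (mtoD H1 H2) as H; rewrite addr0 in H; apply: mto_near H; near=> t.
rewrite -!scalemxAl -scalemxAr -!scalerDr; congr (_ *: _).
rewrite !mulmxBl mulmxBr R0_rho0 rho0_R0.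
move: (Rt t *m rho0 *m Rt t) (rho0 *m Rt t) => x y.
by apply/matrixP => a b; rewrite !mxE; ring.
Unshelve. all: by end_near. Qed.

Lemma rhot_lim : mto F rhot rho0.
Proof.
pose proof (mtoD (mtoZ ec0 rhot_slope) (mto_cst rho0)) as H.
rewrite scale0r add0r in H; apply: mto_near H; near=> t.
have et0 : e t != 0 by near: t.
by rewrite scalerA mulrC mulVec// scale1r subrK.
Unshelve. all: by end_near. Qed.

Lemma tr_taylor2 U U1 U2 : taylor2 F e U U1 U2 -> \tr (rho0 *m U1) = 0 ->
  cto F (fun t => ((e t)^-1 ^+ 2)%:C * (\tr (rho0 *m U t) - 1)) (\tr (rho0 *m U2)).
Proof.
move=> tU t1.
pose proof (mto_tr (mtoM (mto_cst rho0) tU)) as H.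
apply: cto_near H; near=> t.
by rewrite -scalemxAr mxtraceZ !mulmxBr !mxtraceB -scalemxAr mxtraceZ t1 mulr0 subr0 mulmx1 rho0_tr.
Unshelve. all: by end_near. Qed.

(** The first-order term of [U] now pairs with the derivative of [rhot]: this is
    the origin of the shift of the mean. *)
Lemma tr_rhot_taylor2 U U1 U2 : taylor2 F e U U1 U2 -> \tr (rho0 *m U1) = 0 ->
  cto F (fun t => ((e t)^-1 ^+ 2)%:C * (\tr (rhot t *m U t) - 1))
    (\tr (rho0 *m U2) + \tr ((A *m rho0 + rho0 *m A) *m U1)).
Proof.
move=> tU t1.
pose proof (ctoD (mto_tr (mtoM rhot_lim tU)) (mto_tr (mtoM rhot_slope (mto_cst U1)))) as H.
apply: cto_near H; near=> t.
have et0 : e t != 0 by near: t.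
have trt : \tr (rhot t) = 1 by near: t.
rewrite -scalemxAr mxtraceZ -scalemxAl mxtraceZ !mulmxBr mulmxBl !mxtraceB -scalemxAr.
rewrite mxtraceZ t1 subr0 mulmx1 trt.
have -> : ((e t)^-1)%:C = ((e t)^-1 ^+ 2)%:C * (e t)%:C.
  by rewrite -rmorphM; congr (_%:C); field.
by ring.
Unshelve. all: by end_near. Qed.

(** In units of [\tr (rho0 L^2)], the second-order term of [U] contributes [1/8],
    the product of the two first-order terms [1/4], and [\tr (rho0 Rt)] contributes
    [- 1/8]. *)
Lemma tr_cross (L : 'M[R[i]]_D) U : L *m rho0 = 2 *: (A *m rho0) ->
  rho0 *m L = 2 *: (rho0 *m A) -> \tr (rho0 *m A) = 0 ->
  taylor2 F e U (2^-1 *: L) (8^-1 *: (L *m L)) ->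
  cto F (fun t => ((e t)^-1 ^+ 2)%:C * (\tr (rho0 *m (U t *m Rt t)) - 1))
    (4^-1 * \tr (rho0 *m (L *m L))).
Proof.
move=> LA AL tA0 tU.
pose proof (mto_tr (mtoM (mto_cst rho0) (mtoM tU Rt_lim))) as H1.
pose proof (mto_tr (mtoM (mto_cst (rho0 *m (2^-1 *: L))) Rt_slope)) as H2.
pose proof (ctoD (ctoD H1 H2) tr_Rt_second) as H.
have tL0 : \tr (rho0 *m L) = 0 by rewrite AL mxtraceZ tA0 mulr0.
have E1 : \tr (rho0 *m (8^-1 *: (L *m L) *m R0)) = 8^-1 * \tr (rho0 *m (L *m L)).
  rewrite -scalemxAl -scalemxAr mxtraceZ (mulmxA rho0 (L *m L) R0).
  by rewrite (mxtrace_mulC _ R0) (mulmxA R0) R0_rho0.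
have E2 : \tr (rho0 *m (L *m L)) = 4 * \tr (rho0 *m (A *m A)).
  rewrite mulmxA AL -scalemxAl mxtraceZ -mulmxA mxtrace_mulC -mulmxA LA.
  rewrite -scalemxAr mxtraceZ (mulmxA A A rho0) (mxtrace_mulC _ rho0).
  by ring.
have E3 : \tr (rho0 *m (2^-1 *: L) *m A) = 2^-1 * (2 * \tr (rho0 *m (A *m A))).
  by rewrite -scalemxAr -scalemxAl mxtraceZ AL -scalemxAl mxtraceZ -mulmxA.
have EE : \tr (rho0 *m (8^-1 *: (L *m L) *m R0)) + \tr (rho0 *m (2^-1 *: L) *m A) +
    - 2^-1 * \tr (rho0 *m (A *m A)) = 4^-1 * \tr (rho0 *m (L *m L)).
  by rewrite E1 E3 E2; field.
rewrite EE in H; apply: cto_near H; near=> t.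
have et0 : e t != 0 by near: t.
rewrite -scalemxAl -!scalemxAr !mxtraceZ -!scalemxAl mxtraceZ.
have -> : ((e t)^-1)%:C = ((e t)^-1 ^+ 2)%:C * (e t)%:C.
  by rewrite -rmorphM; congr (_%:C); field.
rewrite !mulmxBl !mulmxBr !mxtraceB mul1mx -!scalemxAl -!scalemxAr !mxtraceZ.
have -> : \tr (rho0 *m L *m R0) = 0.
  by rewrite mxtrace_mulC mulmxA R0_rho0.
by rewrite !mulmxA; ring.
Unshelve. all: by end_near. Qed.

End LocalExpansion.

(** * Quasi-characteristic functions of normalized sums *)

Section Products.
Variables (R : realType) (D : nat) (T : Type) (F : set_system T).
Context {FF : Filter F}.
Variable e : T -> R.
Hypothesis e0 : e t @[t --> F] --> (0 : R).
Hypothesis en0 : \forall t \near F, e t != 0.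

Lemma expiH_taylor2 (W : 'M[R[i]]_D) : W \is hermsymmx ->
  taylor2 F e (fun t => expiH ((e t)%:C *: W)) ('i *: W) (- 2^-1 *: (W *m W)).
Proof.
move=> hW; apply: (taylor2_hfun e0 en0 (@csecond_order_expi R)) => //.
by rewrite cos0 sin0.
Qed.

Lemma expH_taylor2 (W : 'M[R[i]]_D) : W \is hermsymmx ->
  taylor2 F e (fun t => expH ((e t)%:C *: W)) W (2^-1 *: (W *m W)).
Proof.
move=> hW; rewrite -[X in taylor2 _ _ _ X _]scale1r.
apply: (taylor2_hfun e0 en0 (@csecond_order_exp R)) => //.
by rewrite expR0.
Qed.

Lemma sum_ltn_recl (V : nmodType) (r : nat) (f : 'I_r.+1 -> 'I_r.+1 -> V) :
  \sum_(t < r.+1) \sum_(u < r.+1 | (t < u)%N) f t u =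
  \sum_(u < r) f ord0 (lift ord0 u)
  + \sum_(t < r) \sum_(u < r | (t < u)%N) f (lift ord0 t) (lift ord0 u).
Proof.
rewrite big_ord_recl big_mkcond big_ord_recl /= add0r; congr (_ + _).
apply: eq_bigr => t _; rewrite big_mkcond big_ord_recl /= add0r.
by rewrite [RHS]big_mkcond; apply: eq_bigr => u _.
Qed.

Lemma prod_expiH_taylor2 (r : nat) (W : 'I_r -> 'M[R[i]]_D) :
  (forall t, W t \is hermsymmx) ->
  taylor2 F e (fun s => \big[mulmx/1%:M]_(t < r) expiH ((e s)%:C *: W t))
    ('i *: \sum_t W t)
    (- 2^-1 *: \sum_t W t *m W t - \sum_(t < r) \sum_(u < r | (t < u)%N) W t *m W u).
Proof.
elim: r W => [|r IH] W hW.
  under eq_fun do rewrite big_ord0.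
  rewrite !big_ord0 !scaler0 subr0; exact: taylor2_1.
under eq_fun do rewrite big_ord_recl.
have H := taylor2M e0 en0 (expiH_taylor2 (hW ord0)) (IH _ (fun t => hW (lift ord0 t))).
have -> : 'i *: \sum_t W t = 'i *: W ord0 + 'i *: \sum_(t < r) W (lift ord0 t).
  by rewrite big_ord_recl scalerDr.
suff -> : - 2^-1 *: \sum_t W t *m W t - \sum_(t < r.+1) \sum_(u < r.+1 | (t < u)%N) W t *m W u =
  - 2^-1 *: (W ord0 *m W ord0) + ('i *: W ord0) *m ('i *: \sum_(t < r) W (lift ord0 t)) +
  (- 2^-1 *: \sum_(t < r) W (lift ord0 t) *m W (lift ord0 t) -
   \sum_(t < r) \sum_(u < r | (t < u)%N) W (lift ord0 t) *m W (lift ord0 u)) by exact: H.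
rewrite big_ord_recl sum_ltn_recl -scalemxAl -scalemxAr scalerA.
have -> : 'i * 'i = -1 :> R[i] by rewrite -expr2 sqr_i.
rewrite mulmx_sumr scaleN1r scalerDr opprD.
move: (_ *: \sum_(i < r) _) (_ *: (W ord0 *m _)) => x y.
move: (\sum_(t < r) \sum_(u < r | _) _) (\sum_(i < r) _ *m _) => z w.
by apply/matrixP => a b; rewrite !mxE; ring.
Qed.

End Products.

Section Gram.
Variables (R : realType) (D m : nat) (rho : 'M[R[i]]_D) (B : 'I_m -> 'M[R[i]]_D).
Hypothesis rho_psd : psd rho.
Hypothesis B_herm : forall i, B i \is hermsymmx.

Lemma conj_tr_herm3 (X Y Z : 'M[R[i]]_D) : X^t* = X -> Y^t* = Y -> Z^t* = Z ->
  (\tr (X *m (Y *m Z)))^* = \tr (X *m (Z *m Y)).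
Proof.
move=> hX hY hZ; rewrite -mxtrace_adj hadjM hadjM hX hY hZ.
by rewrite mxtrace_mulC.
Qed.

(** The quadratic form at [v] is [\tr (rho W W^t* )] with [W = \sum_i v_i B_i]. *)
Lemma gram_psd : psd (\matrix_(i, j) \tr (rho *m (B j *m B i)) : 'M[R[i]]_m).
Proof.
have hB i : (B i)^t* = B i by apply/hermE; exact: B_herm.
split.
  apply/hermE/matrixP => i j; rewrite hadjE !mxE.
  exact: conj_tr_herm3 (psd_herm rho_psd) _ _.
move=> v; pose W := \sum_i v i 0 *: B i.
have -> : (v^t* *m (\matrix_(i, j) \tr (rho *m (B j *m B i))) *m v) 0 0 =
    \tr (rho *m (W *m W^t* )).
  have -> : W^t* = \sum_i (v i 0)^* *: B i.
    rewrite /W (big_morph (fun X : 'M[R[i]]_D => X^t* ) (@hadjD _ _ _) (@hadj0 _ _ _)).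
    by apply: eq_bigr => i _; rewrite hadjZ hB.
  rewrite mxE mulmx_suml mulmx_sumr mxtrace_sum; apply: eq_bigr => j _.
  rewrite mxE mulr_suml mulmx_sumr mulmx_sumr mxtrace_sum; apply: eq_bigr => i _.
  rewrite hadjE mxE -scalemxAl -!scalemxAr !mxtraceZ.
  by ring.
apply: psd_trM_ge0 rho_psd _.
by rewrite -[X in X *m _]trmxCK; exact: psd_gram.
Qed.

End Gram.

(** * The differentiable model *)

Section Model.
Variables (R : realType) (d D : nat) (Theta : set 'rV[R]_d).
Variables (rho : 'rV[R]_d -> 'M[R[i]]_D) (theta0 : 'rV[R]_d).
Variable Rh : 'rV[R]_d -> 'M[R[i]]_D.
Hypothesis open_Theta : open Theta.
Hypothesis Theta_theta0 : Theta theta0.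
Hypothesis rho_density : forall theta, Theta theta -> density (rho theta).
Hypothesis Rh_lr : forall h, Theta (theta0 + h) ->
  sqrt_lr (rho (theta0 + h)) (rho theta0) (Rh h).
Hypothesis Rh_diff : mx_differentiable Rh 0.
Hypothesis Rh_norm :
  (fun h : 'rV[R]_d => 1 - complex.Re (\tr (rho theta0 *m (Rh h *m Rh h))))
    =o_ (nbhs (0 : 'rV[R]_d)) (fun h => \sum_i h 0 i ^+ 2).

Local Notation rho0 := (rho theta0).

Definition dRh (v : 'rV[R]_d) : 'M[R[i]]_D := \matrix_(a, b)
  ('D_v (fun y => complex.Re (Rh y a b)) 0 +i* 'D_v (fun y => complex.Im (Rh y a b)) 0).

Lemma dRh_lin v : dRh v = \sum_i (v 0 i)%:C *: dRh (delta_mx 0 i).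
Proof.
have D_lin (f : 'rV[R]_d -> R) : differentiable f 0 ->
    'D_v f 0 = \sum_i v 0 i * 'D_(delta_mx 0 i) f 0.
  move=> df; rewrite deriveE// {1}[v]row_sum_delta linear_sum.
  by apply: eq_bigr => i _; rewrite linearZ/= deriveE.
apply/matrixP => a b; have [dr di] := Rh_diff a b.
rewrite mxE summxE; under eq_bigr do rewrite !mxE.
apply: complex_ext.
  by rewrite cRe_sum/= D_lin//; apply: eq_bigr => i _; rewrite mul0r subr0.
by rewrite cIm_sum/= D_lin//; apply: eq_bigr => i _; rewrite mul0r addr0.
Qed.

Lemma rho0_density : density rho0. Proof. exact: rho_density. Qed.
Lemma psd_rho0 : psd rho0. Proof. exact: (proj1 rho0_density). Qed.
Lemma tr_rho0 : \tr rho0 = 1. Proof. exact: (proj2 rho0_density). Qed.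

(** Both [Rh 0] and the identity are versions of the likelihood ratio of
    [rho0] with respect to itself. *)
Lemma Rh0_rho0 : Rh 0 *m rho0 = rho0.
Proof.
have H := Rh_lr (h := 0); rewrite addr0 in H.
by rewrite (sqrt_lr_uniq psd_rho0 (H Theta_theta0) (sqrt_lr_refl psd_rho0)) mul1mx.
Qed.

Lemma rho0_Rh0 : rho0 *m Rh 0 = rho0.
Proof.
have [pR _] : sqrt_lr rho0 rho0 (Rh 0) by rewrite -{1}[theta0]addr0; apply: Rh_lr; rewrite addr0.
by rewrite -{1}(psd_herm psd_rho0) -{1}(psd_herm pR) -hadjM Rh0_rho0 (psd_herm psd_rho0).
Qed.

Section Direction.
Variables (T : Type) (F : set_system T).
Context {FF : Filter F}.
Variables (e : T -> R) (v : 'rV[R]_d).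
Hypothesis e0 : e t @[t --> F] --> (0 : R).
Hypothesis en0 : \forall t \near F, e t != 0.

Lemma ev_cvg0 : e t *: v @[t --> F] --> (0 : 'rV[R]_d).
Proof. by rewrite -(scale0r v); apply: cvgZl. Qed.

Lemma near_Theta : \forall t \near F, Theta (theta0 + e t *: v).
Proof.
have H : theta0 + e t *: v @[t --> F] --> theta0.
  by rewrite -[X in _ --> X]addr0; apply: cvgD; [exact: cvg_cst|exact: ev_cvg0].
by apply: H; exact: open_nbhs_nbhs.
Qed.

Lemma Rh_slope : mto F (fun t => ((e t)^-1)%:C *: (Rh (e t *: v) - Rh 0)) (dRh v).
Proof.
have slope (f : 'rV[R]_d -> R) : differentiable f 0 ->
    (e t)^-1 * (f (e t *: v) - f 0) @[t --> F] --> 'D_v f 0.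
  move=> df0; have df : derivable f 0 v by exact: diff_derivable.
  have e0' : e t @[t --> F] --> (0 : R)^'.
    move=> A /= [del /= del0 H]; rewrite /nbhs/=.
    have : \forall t \near F, `|e t| < del by apply: cvgr0_norm_lt e0 _ del0.
    move=> H2; near=> t; apply: H; last by near: t.
    by rewrite /ball/= sub0r normrN; near: t.
  have := cvg_comp _ _ e0' df; apply: cvg_trans; apply: near_eq_cvg; apply: nearW => t.
  by rewrite /= /shift/= addr0.
move=> a b; have [dr di] := Rh_diff a b; rewrite mxE; split.
  under eq_fun do rewrite !mxE cReM cReD cReN/= mul0r subr0.
  exact: slope dr.
under eq_fun do rewrite !mxE cImM cImD cImN/= mul0r addr0.
exact: slope di.
Unshelve. all: by end_near. Qed.

Lemma near_lr : \forall t \near F,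
  sqrt_lr (rho (theta0 + e t *: v)) rho0 (Rh (e t *: v)).
Proof. by apply: filterS near_Theta => t; exact: Rh_lr. Qed.

Lemma near_tr : \forall t \near F, \tr (rho (theta0 + e t *: v)) = 1.
Proof. by apply: filterS near_Theta => t /rho_density[]. Qed.

(** The trace is real, so the condition on its real part controls the complex
    number. *)
Lemma Rh_norm_along : cto F (fun t => ((e t)^-1 ^+ 2)%:C *
  (\tr (rho0 *m (Rh (e t *: v) *m Rh (e t *: v))) - 1)) 0.
Proof.
pose c := \sum_i v 0 i ^+ 2.
have c0 : 0 <= c by apply: sumr_ge0 => i _; rewrite sqr_ge0.
have H : (e t)^-1 ^+ 2 * (1 - complex.Re (\tr (rho0 *m (Rh (e t *: v) *m Rh (e t *: v)))))
    @[t --> F] --> (0 : R).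
  apply/cvgr0Pnorm_le => eps eps0.
  have eta0 : 0 < eps / (1 + c) by rewrite divr_gt0// ltr_pwDl.
  have /eqoP/(_ _ eta0) N := Rh_norm.
  have := ev_cvg0 N; rewrite /nbhs/= => {}N.
  near=> t.
  have et0 : e t != 0 by near: t.
  have : `|1 - complex.Re (\tr (rho0 *m (Rh (e t *: v) *m Rh (e t *: v))))| <=
    eps / (1 + c) * `|\sum_i (e t *: v) 0 i ^+ 2| by near: t.
  have -> : \sum_i (e t *: v) 0 i ^+ 2 = e t ^+ 2 * c.
    by rewrite mulr_sumr; apply: eq_bigr => i _; rewrite mxE exprMn.
  rewrite (ger0_norm (mulr_ge0 (sqr_ge0 _) c0)) normrM ger0_norm ?sqr_ge0// => B.
  have e20 : 0 < e t ^+ 2 by rewrite exprn_even_gt0.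
  rewrite exprVn ler_pdivrMl//; apply: (le_trans B).
  have q1 : c / (1 + c) <= 1 by rewrite ler_pdivrMr ?ltr_pwDl// mul1r lerDr.
  rewrite (_ : _ * (_ * c) = (e t ^+ 2 * eps) * (c / (1 + c))); last by ring.
  by rewrite ler_piMr// mulr_ge0// ltW.
have H1 := cto_real (FF := FF) H.
have H2 : cto F (fun t => - ((e t)^-1 ^+ 2 *
    (1 - complex.Re (\tr (rho0 *m (Rh (e t *: v) *m Rh (e t *: v))))))%:C) (- 0%:C).
  exact: ctoN.
rewrite oppr0 in H2; apply: cto_near H2; near=> t.
have [pR _] : sqrt_lr (rho (theta0 + e t *: v)) rho0 (Rh (e t *: v)).
  by near: t; exact: near_lr.
have real_tr : 0 <= \tr (rho0 *m (Rh (e t *: v) *m Rh (e t *: v))).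
  have := psd_tr_ge0 (psd_conj (Rh (e t *: v)) psd_rho0).
  by rewrite (psd_herm pR) -mulmxA mxtrace_mulC -mulmxA.
rewrite -[X in _ = _ * (X - 1)](RRe_real (ger0_real real_tr)).
by rewrite rmorphM rmorphB -mulrN opprB.
Unshelve. all: by end_near. Qed.

Lemma rho_slope : mto F (fun t => ((e t)^-1)%:C *: (rho (theta0 + e t *: v) - rho0))
  (dRh v *m rho0 + rho0 *m dRh v).
Proof.
exact: (rhot_slope e0 en0 psd_rho0 Rh0_rho0 rho0_Rh0 near_lr near_tr Rh_slope
  Rh_norm_along).
Qed.

End Direction.

Lemma dRh_herm v : dRh v \is hermsymmx.
Proof.
pose proof (Rh_slope v (@rt_cvg0 R) (@rt_neq0 R)) as H.
apply/hermE; apply: (mto_unique (mto_adj H)).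
apply: mto_near H; near=> n.
have [pR _] : sqrt_lr (rho (theta0 + rt R n *: v)) rho0 (Rh (rt R n *: v)).
  by near: n; exact: near_lr (@rt_cvg0 R).
have [pR0 _] : sqrt_lr rho0 rho0 (Rh 0) by rewrite -{1}[theta0]addr0; apply: Rh_lr; rewrite addr0.
by rewrite hadjZ hadjB (psd_herm pR) (psd_herm pR0); congr (_ *: _); exact/esym/conjc_real.
Unshelve. all: by end_near. Qed.

Lemma tr_rho0_dRh v : \tr (rho0 *m dRh v) = 0.
Proof.
exact: (tr_rho0_A (@rt_cvg0 R) (@rt_neq0 R) tr_rho0 Rh0_rho0 rho0_Rh0
  (Rh_slope v (@rt_cvg0 R) (@rt_neq0 R)) (Rh_norm_along v (@rt_cvg0 R) (@rt_neq0 R)) _).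
Qed.

Lemma half_anticomm2 (A B : 'M[R[i]]_D) : half_anticomm (2 *: A) B = A *m B + B *m A.
Proof.
by rewrite /half_anticomm -scalemxAl -scalemxAr -scalerDr scalerA mulVf ?scale1r.
Qed.

Lemma rho_derive v : mx_is_derive rho theta0 v (half_anticomm (2 *: dRh v) rho0).
Proof.
have id0 : (fun x : R => x) t @[t --> (0 : R)^'] --> (0 : R) by exact: nbhs_dnbhs.
have idn0 : \forall t \near (0 : R)^', (fun x : R => x) t != 0 by exact: nbhs_dnbhs_neq.
pose proof (rho_slope v id0 idn0) as H; rewrite half_anticomm2 => a b.
have [Hr Hi] := H a b; split.
  have Hc : h^-1 *: (((fun y => complex.Re (rho y a b)) \o shift theta0) (h *: v) -
      complex.Re (rho0 a b)) @[h --> (0 : R)^'] -->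
      complex.Re ((dRh v *m rho0 + rho0 *m dRh v) a b).
    move: Hr; apply: cvg_trans; apply: near_eq_cvg; apply: nearW => t.
    by rewrite !mxE cReM cReD cReN/= mul0r subr0 [theta0 + _]addrC.
  by apply: DeriveDef; [apply: cvgP Hc|exact: cvg_lim Hc].
have Hc : h^-1 *: (((fun y => complex.Im (rho y a b)) \o shift theta0) (h *: v) -
    complex.Im (rho0 a b)) @[h --> (0 : R)^'] -->
    complex.Im ((dRh v *m rho0 + rho0 *m dRh v) a b).
  move: Hi; apply: cvg_trans; apply: near_eq_cvg; apply: nearW => t.
  by rewrite !mxE cImM cImD cImN/= mul0r addr0 [theta0 + _]addrC.
by apply: DeriveDef; [apply: cvgP Hc|exact: cvg_lim Hc].
Qed.

Lemma sld_exists i : is_sld rho theta0 i (2 *: dRh (delta_mx 0 i)).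
Proof.
split; last exact: rho_derive.
have -> : 2 = (2 : R)%:C by rewrite rmorph_nat.
exact: hermZ (dRh_herm _).
Qed.

(** Two versions of the logarithmic derivative differ by an operator that
    anticommutes with [rho0]. *)
Lemma sld_rho0 i L : is_sld rho theta0 i L ->
  L *m rho0 = 2 *: (dRh (delta_mx 0 i) *m rho0).
Proof.
move=> [hL dL]; have [hA dA] := sld_exists i.
have E : half_anticomm L rho0 = half_anticomm (2 *: dRh (delta_mx 0 i)) rho0.
  apply/matrixP => a b; have [Lr Li] := dL a b; have [Ar Ai] := dA a b.
  apply: complex_ext.
    by rewrite -(@derive_val _ _ _ _ _ _ _ Lr) -(@derive_val _ _ _ _ _ _ _ Ar).
  by rewrite -(@derive_val _ _ _ _ _ _ _ Li) -(@derive_val _ _ _ _ _ _ _ Ai).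
have two0 : (2^-1 : R[i]) != 0 by rewrite invr_eq0 pnatr_eq0.
have {}E := scalerI two0 E.
rewrite scalemxAl; apply/eqP; rewrite -subr_eq0 -mulmxBl; apply/eqP.
apply: (anticomm_eq0 psd_rho0 (hermB hL hA)).
move: (dRh _) E => X E; rewrite mulmxBl mulmxBr addrACA E -opprD.
exact: subrr.
Qed.

Lemma dRh_sld (L : 'I_d -> 'M[R[i]]_D) (h : 'rV[R]_d) :
  (forall i, is_sld rho theta0 i (L i)) ->
  (\sum_i (h 0 i)%:C *: L i) *m rho0 = 2 *: (dRh h *m rho0).
Proof.
move=> sL; rewrite dRh_lin !mulmx_suml scaler_sumr; apply: eq_bigr => i _.
by rewrite -!scalemxAl (sld_rho0 (sL i)) !scalerA mulrC.
Qed.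

Lemma herm_lin m (B : 'I_m -> 'M[R[i]]_D) (c : 'rV[R]_m) :
  (forall i, B i \is hermsymmx) -> \sum_i (c 0 i)%:C *: B i \is hermsymmx.
Proof. by move=> hB; apply: herm_sum => i _; apply: hermZ. Qed.

Lemma expiH_normalized_sum (n : nat) (W : 'M[R[i]]_D) : W \is hermsymmx ->
  expiH (normalized_sum W n) = tpow n (expiH ((rt R n)%:C *: W)).
Proof.
move=> hW; apply: hfun_normalized_sum hW; last by rewrite cos0 sin0.
move=> x y; rewrite cosD sinD.
by apply: complex_ext; rewrite !(cReM, cImM)/=; ring.
Qed.

Lemma cto_tpow (u : nat -> 'M[R[i]]_D) z :
  cto \oo (fun n => ((rt R n)^-1 ^+ 2)%:C * (\tr (u n) - 1)) z ->
  cto \oo (fun n => \tr (tpow n (u n))) (cexp z).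
Proof.
under eq_fun do rewrite rtE; move=> /cto_expn.
by under eq_fun do rewrite -tr_tpow.
Qed.

Lemma tr_lin2 m (B : 'I_m -> 'M[R[i]]_D) (c c' : 'rV[R]_m) :
  \tr (rho0 *m ((\sum_i (c 0 i)%:C *: B i) *m (\sum_i (c' 0 i)%:C *: B i))) =
  \sum_i \sum_j (c 0 i)%:C * (c' 0 j)%:C * \tr (rho0 *m (B i *m B j)).
Proof.
rewrite mulmx_suml mulmx_sumr mxtrace_sum; apply: eq_bigr => i _.
rewrite !mulmx_sumr mxtrace_sum; apply: eq_bigr => j _.
by rewrite -scalemxAl -!scalemxAr !mxtraceZ mulrA.
Qed.

(** [\tr ((A rho0 + rho0 A) W)] is half of [\tr (rho0 L W)] plus its conjugate. *)
Lemma tr_rho_derive m (B : 'I_m -> 'M[R[i]]_D) (L : 'I_d -> 'M[R[i]]_D)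
    (h : 'rV[R]_d) (c : 'rV[R]_m) :
  (forall i, B i \is hermsymmx) -> (forall i, is_sld rho theta0 i (L i)) ->
  \tr ((dRh h *m rho0 + rho0 *m dRh h) *m (\sum_i (c 0 i)%:C *: B i)) =
  (\sum_i c 0 i * \sum_j h 0 j * complex.Re (\tr (rho0 *m (L j *m B i))))%:C.
Proof.
move=> hB sL; set W := \sum_i _ *: B i.
have hW : W^t* = W by apply/hermE; exact: herm_lin.
pose Lh := \sum_i (h 0 i)%:C *: L i.
have hLh : Lh^t* = Lh by apply/hermE; apply: herm_lin => i; have [] := sL i.
have hr := psd_herm psd_rho0; have hA := proj1 (hermE _) (dRh_herm h).
have LA : Lh *m rho0 = 2 *: (dRh h *m rho0) := dRh_sld h sL.
have tA : \tr (rho0 *m (dRh h *m W)) = 2^-1 * \tr (rho0 *m (Lh *m W)).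
  have AL : rho0 *m Lh = 2 *: (rho0 *m dRh h).
    rewrite -{1}hr -{1}hLh -hadjM LA hadjZ hadjM hr hA; congr (_ *: _).
    exact: conjc_nat.
  by rewrite mulmxA (mulmxA _ Lh) AL -scalemxAl mxtraceZ mulKf// pnatr_eq0.
have -> : \tr ((dRh h *m rho0 + rho0 *m dRh h) *m W) =
    (complex.Re (\tr (rho0 *m (Lh *m W))))%:C.
  have -> : (complex.Re (\tr (rho0 *m (Lh *m W))))%:C =
      2^-1 * (\tr (rho0 *m (Lh *m W)) + (\tr (rho0 *m (Lh *m W)))^* ).
    by rewrite addcJ mulKf// pnatr_eq0.
  rewrite mulmxDl mxtraceD mulrDr -tA addrC -[rho0 *m dRh h *m W]mulmxA; congr (_ + _).
  transitivity (2^-1 * \tr (rho0 *m (W *m Lh))).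
    rewrite (mulmxA rho0 W) (mxtrace_mulC _ Lh) (mulmxA Lh) LA.
    by rewrite -scalemxAl mxtraceZ mulKf// pnatr_eq0.
  by congr (_ * _); apply/esym; exact: conj_tr_herm3.
congr (_%:C); rewrite /Lh /W mulmx_suml mulmx_sumr mxtrace_sum cRe_sum.
under [LHS]eq_bigr => j _.
  rewrite -scalemxAl -scalemxAr mxtraceZ mulmx_sumr mulmx_sumr mxtrace_sum.
  rewrite cReM/= mul0r subr0 cRe_sum mulr_sumr.
  under eq_bigr => i _ do rewrite -!scalemxAr mxtraceZ cReM/= mul0r subr0.
  over.
rewrite exchange_big; apply: eq_bigr => i _; rewrite mulr_sumr.
by apply: eq_bigr => j _; rewrite mulrCA.
Qed.

(** Both the central limit theorem for the score and its shifted form under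
    [rho (theta0 + h / sqrt n)]. *)
Lemma cvg_gauss_normalized_sum m (B : 'I_m -> 'M[R[i]]_D) (L : 'I_d -> 'M[R[i]]_D)
    (h : 'rV[R]_d) :
  (forall i, B i \is hermsymmx) -> (forall i, \tr (rho0 *m B i) = 0) ->
  (forall i, is_sld rho theta0 i (L i)) ->
  cvg_gauss (fun n i => normalized_sum (B i) n)
    (fun n => tpow n (rho (local_param theta0 h n)))
    (h *m (map_mx (@complex.Re R) (\matrix_(i, j) \tr (rho0 *m (L j *m B i))))^T)
    (\matrix_(i, j) \tr (rho0 *m (B j *m B i))).
Proof.
move=> hB cB sL r xi.
pose W t := \sum_i (xi t 0 i)%:C *: B i.
have hW t : W t \is hermsymmx by exact: herm_lin.
under eq_fun => n.
  under eq_bigr => t _ do rewrite normalized_sum_lin (expiH_normalized_sum n (hW t)).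
  rewrite -tpow_prod -tpowM.
  over.
pose proof (prod_expiH_taylor2 (@rt_cvg0 R) (@rt_neq0 R) hW) as tU.
have t1 : \tr (rho0 *m ('i *: \sum_t W t)) = 0.
  rewrite -scalemxAr mxtraceZ mulmx_sumr mxtrace_sum big1 ?mulr0// => t _.
  rewrite mulmx_sumr mxtrace_sum big1// => i _.
  by rewrite -scalemxAr mxtraceZ cB mulr0.
pose proof (tr_rhot_taylor2 (@rt_cvg0 R) (@rt_neq0 R) psd_rho0 Rh0_rho0 rho0_Rh0
  (near_lr h (@rt_cvg0 R)) (near_tr h (@rt_cvg0 R)) (Rh_slope h (@rt_cvg0 R) (@rt_neq0 R))
  (Rh_norm_along h (@rt_cvg0 R) (@rt_neq0 R)) tU t1) as H.
have := cto_tpow H.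
suff -> : gauss_qchar (h *m (map_mx (@complex.Re R)
    (\matrix_(i, j) \tr (rho0 *m (L j *m B i))))^T)
    (\matrix_(i, j) \tr (rho0 *m (B j *m B i))) xi = cexp
  (\tr (rho0 *m (- 2^-1 *: (\sum_t W t *m W t) - \sum_(t < r) \sum_(u < r | (t < u)%N) W t *m W u))
   + \tr ((dRh h *m rho0 + rho0 *m dRh h) *m ('i *: \sum_t W t))) by exact: id.
rewrite /gauss_qchar; congr cexp.
rewrite mulmxBr mxtraceB -[in RHS]scalemxAr mxtraceZ -[in RHS]scalemxAr mxtraceZ.
rewrite addrAC; congr (_ - _).
  rewrite big_split /= addrC; congr (_ + _).
    rewrite mulmx_sumr mxtrace_sum mulr_sumr; apply: eq_bigr => t _.
    rewrite tr_lin2 mulNr; congr (- (_ * _)).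
    by apply: eq_bigr => i _; apply: eq_bigr => j _; rewrite mxE.
  rewrite mulmx_sumr mxtrace_sum mulr_sumr; apply: eq_bigr => t _.
  rewrite (tr_rho_derive h (xi t) hB sL).
  have -> : forall x : R, 0 +i* x = 'i * x%:C.
    by move=> x; apply: complex_ext; rewrite !(cReM, cImM)/=; ring.
  congr ('i * _%:C); apply: eq_bigr => i _; congr (_ * _).
  by rewrite mxE; apply: eq_bigr => j _; rewrite !mxE.
rewrite mulmx_sumr mxtrace_sum; apply: eq_bigr => t _.
rewrite mulmx_sumr mxtrace_sum; apply: eq_bigr => u _.
rewrite tr_lin2; apply: eq_bigr => i _; apply: eq_bigr => j _.
by rewrite mxE.
Qed.

(** * The Gaussian amplitude approximating the likelihood ratio *)

Section Amplitude.
Variables (L : 'I_d -> 'M[R[i]]_D) (h : 'rV[R]_d).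
Hypothesis sL : forall i, is_sld rho theta0 i (L i).

Definition sld_dir : 'M[R[i]]_D := \sum_i (h 0 i)%:C *: L i.
Local Notation Lh := sld_dir.
(** The quadratic form [J_ij h^i h^j]. *)
Definition sld_info : R := complex.Re (\tr (rho0 *m (Lh *m Lh))).
Local Notation j := sld_info.

Lemma sld_dir_herm : Lh \is hermsymmx.
Proof. by apply: herm_lin => i; have [] := sL i. Qed.

Lemma sld_infoE : \tr (rho0 *m (Lh *m Lh)) = j%:C.
Proof.
apply/esym/RRe_real/ger0_real; apply: psd_trM_ge0 psd_rho0 _.
by rewrite -{1}(proj1 (hermE _) sld_dir_herm); exact: psd_gram.
Qed.

Lemma sld_dir_rho0 : Lh *m rho0 = 2 *: (dRh h *m rho0).
Proof. exact: dRh_sld. Qed.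

Lemma rho0_sld_dir : rho0 *m Lh = 2 *: (rho0 *m dRh h).
Proof.
have hA := proj1 (hermE _) (dRh_herm h).
have hL := proj1 (hermE _) sld_dir_herm; have hr := psd_herm psd_rho0.
rewrite -{1}hr -{1}hL -hadjM sld_dir_rho0 hadjZ hadjM hr hA; congr (_ *: _).
exact: conjc_nat.
Qed.

Lemma tr_rho0_sld_dir : \tr (rho0 *m Lh) = 0.
Proof. by rewrite rho0_sld_dir mxtraceZ tr_rho0_dRh mulr0. Qed.

Lemma exp_normalized_sum (s : R) n :
  hfun (fun x => (expR (s * x))%:C) (normalized_sum Lh n) =
  tpow n (expH ((rt R n)%:C *: (s%:C *: Lh))).
Proof.
have hW : (rt R n)%:C *: Lh \is hermsymmx by apply: hermZ; exact: sld_dir_herm.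
have -> : (rt R n)%:C *: (s%:C *: Lh) = s%:C *: ((rt R n)%:C *: Lh).
  by rewrite !scalerA mulrC.
rewrite /expH (hfun_scale _ _ hW); apply: hfun_normalized_sum; last exact: sld_dir_herm.
- by move=> x y; rewrite mulrDr expRD rmorphM.
- by rewrite mulr0 expR0.
Qed.

Lemma exp_moment (s : R) : cto \oo
  (fun n => \tr (tpow n rho0 *m hfun (fun x => (expR (s * x))%:C) (normalized_sum Lh n)))
  (expR (s ^+ 2 / 2 * j))%:C.
Proof.
under eq_fun do rewrite exp_normalized_sum -tpowM.
rewrite -cexp_real; apply: cto_tpow.
have hW : s%:C *: Lh \is hermsymmx by apply: hermZ; exact: sld_dir_herm.
pose proof (expH_taylor2 (@rt_cvg0 R) (@rt_neq0 R) hW) as tU.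
have t1 : \tr (rho0 *m (s%:C *: Lh)) = 0.
  by rewrite -scalemxAr mxtraceZ tr_rho0_sld_dir mulr0.
pose proof (tr_taylor2 tr_rho0 tU t1) as H.
suff <- : \tr (rho0 *m (2^-1 *: (s%:C *: Lh *m (s%:C *: Lh)))) = (s ^+ 2 / 2 * j)%:C by [].
rewrite -scalemxAl -!scalemxAr !mxtraceZ sld_infoE.
by rewrite !rmorphM fmorphV rmorph_nat/=; ring.
Qed.

(** The square root [exp ((x - j / 2) / 2)] of the Gaussian likelihood ratio,
    evaluated at the score in the direction [h]. *)
Definition amplitude n : 'M[R[i]]_(tdim D n) :=
  hfun (fun x => (expR (2^-1 * x - 4^-1 * j))%:C) (normalized_sum Lh n).

Lemma amplitude_psd n : psd (amplitude n).
Proof. by apply: hfun_psd => x; exact: expR_ge0. Qed.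

Lemma amplitudeE n : amplitude n =
  (expR (- (4^-1 * j)))%:C *:
    hfun (fun x => (expR (2^-1 * x))%:C) (normalized_sum Lh n).
Proof.
by rewrite -hfunZ; apply: eq_hfun => x; rewrite -rmorphM -expRD addrC.
Qed.

(** [exp (j / 2)] from the score compensates the normalization [exp (- j / 2)]. *)
Lemma amplitude_sq : cto \oo (fun n => \tr (tpow n rho0 *m (amplitude n *m amplitude n))) 1.
Proof.
pose proof (ctoM (cto_cst (expR (- (2^-1 * j)))%:C) (exp_moment 1)) as H.
have E1 : (expR (- (2^-1 * j)))%:C * (expR (1 ^+ 2 / 2 * j))%:C = 1 :> R[i].
  by rewrite -rmorphM -expRD expr1n mul1r addNr expR0.
rewrite E1 in H; apply: cto_near H; apply: nearW => n.
have -> : amplitude n *m amplitude n = (expR (- (2^-1 * j)))%:C *: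
    hfun (fun x => (expR (1 * x))%:C) (normalized_sum Lh n).
  rewrite /amplitude hfunM -hfunZ; apply: eq_hfun => x.
  by rewrite -!rmorphM -!expRD; congr (expR _)%:C; field.
by rewrite -scalemxAr mxtraceZ.
Qed.

Lemma amplitude_Rh : cto \oo (fun n => \tr (tpow n rho0 *m
  (amplitude n *m tpow n (Rh (rt R n *: h))))) 1.
Proof.
have hW : (2^-1 : R)%:C *: Lh \is hermsymmx by apply: hermZ; exact: sld_dir_herm.
pose proof (expH_taylor2 (@rt_cvg0 R) (@rt_neq0 R) hW) as tU.
have E2 : 2^-1 *: ((2^-1 : R)%:C *: Lh *m ((2^-1 : R)%:C *: Lh)) = 8^-1 *: (Lh *m Lh).
  rewrite -scalemxAl -!scalemxAr !scalerA; congr (_ *: _).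
  by rewrite fmorphV rmorph_nat; field.
have E3 : (2^-1 : R)%:C *: Lh = 2^-1 *: Lh by rewrite fmorphV rmorph_nat.
rewrite E2 E3 in tU.
pose proof (tr_cross (@rt_cvg0 R) (@rt_neq0 R) tr_rho0 Rh0_rho0 rho0_Rh0
  (Rh_slope h (@rt_cvg0 R) (@rt_neq0 R)) (Rh_norm_along h (@rt_cvg0 R) (@rt_neq0 R))
  sld_dir_rho0 rho0_sld_dir (tr_rho0_dRh h) tU) as H.
have Z := cto_tpow H.
have E4 : 4^-1 * \tr (rho0 *m (Lh *m Lh)) = (4^-1 * j)%:C.
  by rewrite sld_infoE rmorphM fmorphV rmorph_nat.
rewrite E4 cexp_real in Z.
pose proof (ctoM (cto_cst (expR (- (4^-1 * j)))%:C) Z) as HH.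
have E1 : (expR (- (4^-1 * j)))%:C * (expR (4^-1 * j))%:C = 1 :> R[i].
  by rewrite -rmorphM -expRD addNr expR0.
rewrite E1 in HH; apply: cto_near HH; apply: nearW => n.
by rewrite amplitudeE exp_normalized_sum E3 -scalemxAl -scalemxAr mxtraceZ !tpowM.
Qed.

Lemma Rh_sq : cto \oo (fun n => \tr (tpow n rho0 *m
  (tpow n (Rh (rt R n *: h)) *m tpow n (Rh (rt R n *: h))))) 1.
Proof.
under eq_fun do rewrite -!tpowM.
rewrite -cexp0; apply: cto_tpow.
exact: (Rh_norm_along h (@rt_cvg0 R) (@rt_neq0 R)).
Qed.

Lemma near_Rh_lr : \forall n \near \oo,
  sqrt_lr (rho (theta0 + rt R n *: h)) rho0 (Rh (rt R n *: h)).
Proof. exact: (near_lr h (@rt_cvg0 R)). Qed.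

(** The three limits [1 - 2 + 1] of the expanded square. *)
Lemma amplitude_approx : cto \oo (fun n => \tr (tpow n rho0 *m
  ((amplitude n - tpow n (Rh (rt R n *: h))) *m
   (amplitude n - tpow n (Rh (rt R n *: h)))))) 0.
Proof.
pose proof (ctoD (ctoB (ctoB amplitude_sq amplitude_Rh) (cto_conj amplitude_Rh)) Rh_sq) as H.
have E : 1 - 1 - 1^* + 1 = 0 :> R[i] by rewrite rmorph1 subrr sub0r addNr.
rewrite E in H; apply: cto_near H; near=> n.
have [pR _] : sqrt_lr (rho (theta0 + rt R n *: h)) rho0 (Rh (rt R n *: h)).
  by near: n; exact: near_Rh_lr.
rewrite mulmx_subsub mxtraceD !mxtraceB; congr (_ - _ - _ + _).
apply: conj_tr_herm3; apply: psd_herm.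
- exact: psd_tpow psd_rho0.
- exact: amplitude_psd.
- exact: psd_tpow pR.
Unshelve. all: by end_near. Qed.

(** The squared distance only depends on [Rn rho0^n], which is the same for all
    versions. *)
Lemma amplitude_approx_version (Rn : forall n, 'M[R[i]]_(tdim D n)) :
  (\forall n \near \oo, sqrt_lr (tpow n (rho (theta0 + rt R n *: h))) (tpow n rho0) (Rn n)) ->
  cto \oo (fun n => \tr (tpow n rho0 *m
    ((amplitude n - Rn n) *m (amplitude n - Rn n)))) 0.
Proof.
move=> Rn_lr; apply: cto_near amplitude_approx; near=> n.
have lrn : sqrt_lr (tpow n (rho (theta0 + rt R n *: h))) (tpow n rho0) (Rn n) by near: n.
have lrh : sqrt_lr (rho (theta0 + rt R n *: h)) rho0 (Rh (rt R n *: h)).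
  by near: n; exact: near_Rh_lr.
have pr := psd_tpow n psd_rho0.
have lrt := sqrt_lr_tpow n psd_rho0 lrh.
have U := sqrt_lr_uniq pr lrn lrt.
have hE := psd_herm (amplitude_psd n).
have hX := psd_herm (proj1 lrn); have hY := psd_herm (proj1 lrt); have hr := psd_herm pr.
move: (amplitude n) (Rn n) (tpow n (Rh _)) (tpow n rho0) U hE hX hY hr => E X Y r U hE hX hY hr.
have V : (E - X) *m r = (E - Y) *m r by rewrite !mulmxBl U.
have V' : r *m (E - X) = r *m (E - Y).
  by rewrite -[in LHS]hr -hE -hX -hadjB -hadjM V hadjM hadjB hr hE hY.
rewrite (mulmxA r (E - X)) V' (mulmxA r (E - Y)) mxtrace_mulC [RHS]mxtrace_mulC.
by rewrite (mulmxA _ r) [in RHS](mulmxA _ r) V.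
Unshelve. all: by end_near. Qed.

Lemma near_admissible : \forall n \near \oo, admissible Theta theta0 h n.
Proof.
near=> n; split; first by near: n; exists 1%N.
by near: n; exact: (near_Theta h (@rt_cvg0 R)).
Unshelve. all: by end_near. Qed.

Lemma amplitude_remainder (Rn : forall n, 'M[R[i]]_(tdim D n)) :
  (forall n, admissible Theta theta0 h n ->
     sqrt_lr (tpow n (rho (local_param theta0 h n))) (tpow n rho0) (Rn n)) ->
  exists2 O : forall n, 'M[R[i]]_(tdim D n),
    oL2 (fun n => tpow n rho0) O &
    forall n, admissible Theta theta0 h n -> amplitude n = Rn n + O n.
Proof.
move=> Rn_lr.
(* [Rn n] need not be Hermitian at the other indices *)
pose O n := if `[< admissible Theta theta0 h n >] then amplitude n - Rn n else 0.
exists O; last by move=> n /asboolP an; rewrite /O an addrC subrK.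
split.
  move=> n; rewrite /O; case: ifP => [/asboolP an|_]; last exact: herm0.
  exact: hermB (proj1 (amplitude_psd n)) (proj1 (proj1 (Rn_lr n an))).
have lrn : \forall n \near \oo,
    sqrt_lr (tpow n (rho (theta0 + rt R n *: h))) (tpow n rho0) (Rn n).
  by apply: filterS near_admissible => n; exact: Rn_lr.
apply: cto_near (amplitude_approx_version lrn).
by apply: filterS near_admissible => n /asboolP an; rewrite /O an.
Qed.

Lemma sld_info_sum : \sum_i \sum_k
    (\matrix_(i, k) \tr (rho0 *m (L k *m L i)) : 'M[R[i]]_d) i k *
      (h 0 i)%:C * (h 0 k)%:C = j%:C.
Proof.
rewrite -sld_infoE tr_lin2 exchange_big; apply: eq_bigr => i _.
by apply: eq_bigr => k _; rewrite mxE; ring.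
Qed.

Lemma amplitude_expH n :
  expH (2%:R^-1 *: (\sum_i (h 0 i)%:C *: normalized_sum (L i) n
    - (2%:R^-1 * \sum_i \sum_k
        (\matrix_(i, k) \tr (rho0 *m (L k *m L i)) : 'M[R[i]]_d) i k *
          (h 0 i)%:C * (h 0 k)%:C)%:M + 0)) = amplitude n.
Proof.
have hN : normalized_sum Lh n \is hermsymmx by apply: herm_normalized_sum; exact: sld_dir_herm.
have half (x : R) : 2%:R^-1 * x%:C = (2^-1 * x)%:C.
  by rewrite rmorphM fmorphV rmorph_nat.
rewrite normalized_sum_lin addr0 sld_info_sum half.
have -> : 2%:R^-1 *: (normalized_sum Lh n - (2^-1 * j)%:C%:M) =
    (2^-1 : R)%:C *: normalized_sum Lh n + (- (4^-1 * j))%:C *: 1%:M.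
  have -> : (2^-1 : R)%:C = 2%:R^-1 by rewrite fmorphV rmorph_nat.
  have -> : (- (4^-1 * j))%:C = - (2%:R^-1 * (2^-1 * j)%:C).
    by rewrite half -rmorphN; congr (_%:C); field.
  move: (normalized_sum Lh n) (_%:C) => N c; apply/matrixP => a b; rewrite !mxE.
  by case: (a == b); rewrite ?mulr1n ?mulr0n; ring.
exact: hfun_affine.
Qed.

(** Where the amplitude [w] exceeds [M] one has [w^2 <= w^4 / M^2], and the fourth
    moment of the amplitude converges. *)
Lemma amplitude_unif_integrable (E : set nat) (A : forall n, 'M[R[i]]_(tdim D n)) :
  (forall n, E n -> A n = amplitude n) ->
  sq_unif_integrable E (fun n => tpow n rho0) A.
Proof.
move=> AE.
pose m n := complex.Re (\tr (tpow n rho0 *m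
  hfun (fun x => (expR (2 * x - j))%:C) (normalized_sum Lh n))).
have [K K0 mK] : exists2 K, 0 < K & forall n, m n <= K.
  have : cvgn m.
    pose proof (ctoM (cto_cst (expR (- j))%:C) (exp_moment 2)) as H.
    have H' : cto \oo (fun n => \tr (tpow n rho0 *m
        hfun (fun x => (expR (2 * x - j))%:C) (normalized_sum Lh n)))
        ((expR (- j))%:C * (expR (2 ^+ 2 / 2 * j))%:C).
      apply: cto_near H; apply: nearW => n.
      have -> : hfun (fun x => (expR (2 * x - j))%:C) (normalized_sum Lh n) =
          (expR (- j))%:C *: hfun (fun x => (expR (2 * x))%:C) (normalized_sum Lh n).
        by rewrite -hfunZ; apply: eq_hfun => x; rewrite -rmorphM -expRD addrC.
      by rewrite -scalemxAr mxtraceZ.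
    by apply: cvgP; exact: (proj1 H').
  move=> /cvg_seq_bounded [K [_ HK]].
  exists (`|K| + 1); first by rewrite ltr_pwDr.
  move=> n; apply: (le_trans (ler_norm _)); apply: (HK (`|K| + 1)) => //.
  by rewrite (le_lt_trans (ler_norm _))// ltrDl.
have bound (M : R) n : 0 < M -> complex.Re (\tr (tpow n rho0 *m
    (amplitude n *m amplitude n) *m (1%:M - truncH M (amplitude n)))) <= (M ^+ 2)^-1 * K.
  move=> M0.
  have hN : normalized_sum Lh n \is hermsymmx by apply: herm_normalized_sum; exact: sld_dir_herm.
  pose w x := expR (2^-1 * x - 4^-1 * j).
  pose c x : R := if `|w x| <= M then 1 else 0.
  have Tc : truncH M (amplitude n) = hfun (fun x => (c x)%:C) (normalized_sum Lh n).
    rewrite /truncH (hfun_comp _ _ hN); apply: eq_hfun => x.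
    by rewrite /c /w; case: ifP.
  have Eg : amplitude n *m amplitude n *m (1%:M - truncH M (amplitude n)) =
      hfun (fun x => (w x * w x * (1 - c x))%:C) (normalized_sum Lh n).
    rewrite Tc -(hfun_cst1 (normalized_sum Lh n)) -hfunB /amplitude !hfunM.
    by apply: eq_hfun => x; rewrite !rmorphM rmorphB.
  apply: (@le_trans _ _ ((M ^+ 2)^-1 * m n)); last first.
    by rewrite ler_wpM2l// invr_ge0 sqr_ge0.
  rewrite -mulmxA Eg -subr_ge0.
  pose k x := (M ^+ 2)^-1 * expR (2 * x - j) - w x * w x * (1 - c x).
  have k0 x : 0 <= k x.
    have w4 : expR (2 * x - j) = (w x * w x) * (w x * w x).
      by rewrite /w -!expRD; congr expR; field.
    have w0 : 0 < w x by exact: expR_gt0.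
    rewrite /k /c w4 ger0_norm ?(ltW w0)//; case: (leP (w x) M) => wM.
      by rewrite subrr mulr0 subr0 mulr_ge0 ?invr_ge0 ?sqr_ge0// !mulr_ge0// ltW.
    rewrite !subr0 mulr1 subr_ge0 mulrCA ler_peMr ?mulr_ge0 ?(ltW w0)//.
    rewrite ler_pdivlMl ?exprn_gt0// mulr1 expr2.
    by apply: ler_pM => //; rewrite ltW.
  have := psd_trM_ge0 (psd_tpow n psd_rho0) (hfun_psd (normalized_sum Lh n) k0).
  have -> : hfun (fun x => (k x)%:C) (normalized_sum Lh n) =
      ((M ^+ 2)^-1)%:C *: hfun (fun x => (expR (2 * x - j))%:C) (normalized_sum Lh n) -
      hfun (fun x => (w x * w x * (1 - c x))%:C) (normalized_sum Lh n).
    rewrite -hfunZ -hfunB; apply: eq_hfun => x.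
    by rewrite /k rmorphB rmorphM.
  rewrite mulmxBr mxtraceB -scalemxAr mxtraceZ lecE => /andP[_].
  by rewrite cReD cReN cReM/= mul0r subr0.
(* this [M] gives [K / M^2 <= K / M <= eps / 2] *)
move=> eps eps0; pose M := 1 + 2 * K / eps.
have M1 : 1 <= M by rewrite lerDl divr_ge0 ?(ltW eps0)// mulr_ge0// ltW.
have M0 : 0 < M by exact: lt_le_trans ltr01 M1.
exists M => //.
apply: (@le_lt_trans _ _ (eps / 2)%:E); last first.
  by rewrite lte_fin ltr_pdivrMr// ltr_pMr// ltr1n.
apply: ge_ereal_sup => _ [n En <-]; rewrite lee_fin (AE n En).
apply: (le_trans (bound M n M0)).
rewrite ler_pdivrMl ?exprn_gt0//.
have MK : K <= M * (eps / 2).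
  have -> : M * (eps / 2) = eps / 2 + K by rewrite /M; field; rewrite gt_eqF.
  by rewrite lerDr divr_ge0// ltW.
apply: (le_trans MK); rewrite ler_wpM2r ?divr_ge0 ?(ltW eps0)//.
by rewrite expr2 ler_peMr// ltW.
Qed.

Lemma rhoh_contiguous : contiguous (admissible Theta theta0 h)
  (fun n => tpow n (rho (local_param theta0 h n))) (fun n => tpow n rho0).
Proof.
pose A n := tpow n (Rh (rt R n *: h)).
have A_lr n : admissible Theta theta0 h n ->
    sqrt_lr (tpow n (rho (local_param theta0 h n))) (tpow n rho0) (A n).
  by move=> [_ Tn]; apply: sqrt_lr_tpow psd_rho0 _; exact: Rh_lr.
have [rem remL2 remE] := amplitude_remainder A_lr.
exists A; split=> //; first exact: Rh_sq.
exists rem; split=> //.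
  by move=> n /remE <-; exact: amplitude_psd.
by apply: amplitude_unif_integrable => n /remE.
Qed.

(** [\tr (rho0 L^2) = 0] forces [L rho0 = 0], so that the model would be stationary
    in the direction [h]. *)
Lemma sld_info_gt0 : half_anticomm Lh rho0 <> 0 -> 0 < j.
Proof.
have hL := proj1 (hermE _) sld_dir_herm.
have pL : psd (Lh *m Lh) by rewrite -{1}hL; exact: psd_gram.
move=> H; have := psd_trM_ge0 psd_rho0 pL.
rewrite sld_infoE ler0c le_eqVlt => /orP[/eqP j0|//]; exfalso; apply: H.
have Z : rho0 *m (Lh *m Lh) = 0.
  by apply: (psd_trM_eq0 psd_rho0 pL); rewrite sld_infoE -j0.
have Lr0 : Lh *m rho0 = 0.
  apply: gram_eq0; rewrite hadjM (psd_herm psd_rho0) hL.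
  by rewrite !mulmxA -(mulmxA rho0 Lh Lh) Z mul0mx.
have rL0 : rho0 *m Lh = 0.
  by rewrite -[in LHS](psd_herm psd_rho0) -hL -hadjM Lr0 hadj0.
by rewrite /half_anticomm Lr0 rL0 addr0 scaler0.
Qed.

End Amplitude.

End Model.

(** * Local asymptotic normality *)

Theorem theorem7p6 (R : realType) (d D : nat) (Theta : set 'rV[R]_d)
    (rho : 'rV[R]_d -> 'M[R[i]]_D) (theta0 : 'rV[R]_d)
    (Rh : 'rV[R]_d -> 'M[R[i]]_D) :
  open Theta ->
  Theta theta0 ->
  (forall theta, Theta theta -> density (rho theta)) ->
  (forall h, Theta (theta0 + h) ->
     sqrt_lr (rho (theta0 + h)) (rho theta0) (Rh h)) ->
  mx_differentiable Rh 0 ->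
  (fun h : 'rV[R]_d => 1 - complex.Re (\tr (rho theta0 *m (Rh h *m Rh h))))
    =o_ (nbhs (0 : 'rV[R]_d)) (fun h => \sum_i h 0 i ^+ 2) ->
  (forall i : 'I_d, exists Li, is_sld rho theta0 i Li) /\
  forall L : 'I_d -> 'M[R[i]]_D,
  (forall i, is_sld rho theta0 i (L i)) ->
  let J : 'M[R[i]]_d := \matrix_(i, j) \tr (rho theta0 *m (L j *m L i)) in
  let Delta n (i : 'I_d) := normalized_sum (L i) n in
  let rho0 n := tpow n (rho theta0) in
  let rhoh (h : 'rV[R]_d) n := tpow n (rho (local_param theta0 h n)) in
  let hDelta (h : 'rV[R]_d) n := \sum_i (h 0 i)%:C *: Delta n i in
  [/\ [/\ cvg_gauss Delta rho0 0 J,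
          psd J &
          (forall c : 'rV[R]_d,
             \sum_i (c 0 i)%:C *: half_anticomm (L i) (rho theta0) = 0 ->
             c = 0) ->
          forall v : 'rV[R]_d, v != 0 ->
            0 < (v *m map_mx (@complex.Re R) J *m v^T) 0 0],
      forall (h : 'rV[R]_d) (Rn : forall n, 'M[R[i]]_(tdim D n)),
        (forall n, admissible Theta theta0 h n ->
           sqrt_lr (rhoh h n) (rho0 n) (Rn n)) ->
        exists O1 O2 : forall n, 'M[R[i]]_(tdim D n),
          [/\ oD (hDelta h) rho0 O1,
              oL2 rho0 O2 &
              forall n, admissible Theta theta0 h n ->
                Rn n = expH (2%:R^-1 *:
                         (hDelta h n
                          - (2%:R^-1 * \sum_i \sum_j
                               J i j * (h 0 i)%:C * (h 0 j)%:C)%:M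
                          + O1 n))
                       - O2 n],
      forall h : 'rV[R]_d,
        contiguous (admissible Theta theta0 h) (rhoh h) rho0 &
      forall (d' : nat) (B : 'I_d' -> 'M[R[i]]_D),
        (forall i, B i \is hermsymmx) ->
        (forall i, \tr (rho theta0 *m B i) = 0) ->
        let X n (i : 'I_d') := normalized_sum (B i) n in
        let Sigma : 'M[R[i]]_d' :=
          \matrix_(i, j) \tr (rho theta0 *m (B j *m B i)) in
        let tau : 'M[R[i]]_(d', d) :=
          \matrix_(i, j) \tr (rho theta0 *m (L j *m B i)) in
        psd Sigma /\
        forall h : 'rV[R]_d,
          cvg_gauss X (rhoh h) (h *m (map_mx (@complex.Re R) tau)^T) Sigma].
Proof.
move=> oT T0 dens lr diffR normR; split.
  move=> i; exists (2 *: dRh Rh (delta_mx 0 i)).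
  exact: (sld_exists oT T0 dens lr diffR normR).
move=> L sL J Delta rho0 rhoh hDelta.
have hL i : L i \is hermsymmx by have [] := sL i.
have pr := psd_rho0 T0 dens.
have Delta_gauss : cvg_gauss Delta rho0 0 J.
  have tL i : \tr (rho theta0 *m L i) = 0.
    rewrite mxtrace_mulC (sld_rho0 oT T0 dens lr diffR normR (sL i)) mxtraceZ mxtrace_mulC.
    by rewrite (tr_rho0_dRh oT T0 dens lr diffR normR) mulr0.
  have H : cvg_gauss Delta (rhoh 0)
      (0 *m (map_mx (@complex.Re R) (\matrix_(i, j) \tr (rho theta0 *m (L j *m L i))))^T) J.
    exact: (cvg_gauss_normalized_sum oT T0 dens lr diffR normR 0 hL tL sL).
  rewrite mul0mx in H.
  suff -> : rho0 = rhoh 0 by [].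
  by apply: functional_extensionality_dep => n; rewrite /rhoh /local_param scaler0 addr0.
split.
- split; first exact: Delta_gauss.
  + exact: (gram_psd pr hL).
  + move=> indep v v0.
    have -> : (v *m map_mx (@complex.Re R) J *m v^T) 0 0 = sld_info rho theta0 L v.
      have := congr1 (@complex.Re R) (sld_info_sum T0 dens v sL).
      rewrite cRe_sum => /= <-; rewrite mxE.
      under [LHS]eq_bigr => k _ do rewrite mxE mulr_suml.
      rewrite exchange_big; apply: eq_bigr => i _; rewrite cRe_sum.
      by apply: eq_bigr => k _; rewrite !mxE !cReM !cImM/=; ring.
    apply: (sld_info_gt0 T0 dens sL) => Z; move/eqP: v0; apply; apply: indep.
    rewrite -[RHS]Z /half_anticomm /sld_dir mulmx_suml mulmx_sumr -big_split scaler_sumr.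
    apply: eq_bigr => i _ /=.
    by rewrite -scalemxAl -scalemxAr -scalerDr !scalerA mulrC.
- move=> h Rn Rn_lr.
  have [rem remL2 remE] := amplitude_remainder oT T0 dens lr diffR normR sL Rn_lr.
  (* the amplitude is an exact exponential of the score *)
  exists (fun=> 0), rem; split; [|exact: remL2|].
  + split; first by move=> n; exact: herm0.
    move=> r xi eta.
    have H := Delta_gauss r (fun t => xi t *: h).
    have E n t : (xi t)%:C *: hDelta h n = \sum_i ((xi t *: h) 0 i)%:C *: Delta n i.
      rewrite /hDelta scaler_sumr; apply: eq_bigr => i _.
      by rewrite scalerA mxE rmorphM.
    exists (gauss_qchar 0 J (fun t => xi t *: h)); split.
      under eq_fun do under eq_bigr do rewrite scaler0 addr0 E.
      exact: H.
    under eq_fun do under eq_bigr do rewrite E.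
    exact: H.
  + move=> n an; rewrite (amplitude_expH T0 dens h sL n) (remE n an).
    by rewrite addrK.
- move=> h; exact: (rhoh_contiguous oT T0 dens lr diffR normR h sL).
- move=> d' B hB cB X Sigma tau; split; first exact: (gram_psd pr hB).
  move=> h; exact: (cvg_gauss_normalized_sum oT T0 dens lr diffR normR h hB cB sL).
Qed.
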